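(* Let $(M^n,g,\phi,\lambda)$ be a manifold with density such that either (i) $(M^n,g,\phi,\lambda)$ is a gradient Ricci soliton, i.e. $P_\phi=0$; or (ii) $g$ is flat (equivalently, $(M^n,g,\phi,\lambda)$ is locally conformally flat in the weighted sense). Set $$(g_u)_{ij}=g_{ij}+2u(P_\phi)_{ij}+u^2(P_\phi)_{ik}(P_\phi)^k_j,\qquad \phi_u=\phi-uY_\phi .$$ Then $(\widetilde{\mathcal G},\widetilde g,\widetilde\phi,\lambda)$ with $$\widetilde g=2\,du\,dv+g_u,\qquad \widetilde\phi=\phi_u-v+\lambda uv$$ is a weighted ambient space for $(M^n,g,\phi,\lambda)$.
   Context: A manifold with density $(M^n,g,\phi,\lambda)$ is a Riemannian manifold $(M^n,g)$ with $\phi\in C^\infty(M)$ (and measure $e^{-\phi}\mathrm{dvol}_g$) and $\lambda\in\mathbb R$; $M$ is assumed connected. For a (pseudo-)Riemannian manifold of dimension $m$ with $\phi,\lambda$ put $P_\phi=\mathrm{Ric}+\nabla^2\phi-\lambda g$, $F_\phi=\Delta\phi-|\nabla\phi|^2+2\lambda\phi-m\lambda$, $Y_\phi=-\tfrac12[R+|\nabla\phi|^2-2\lambda\phi]$. $\widetilde P_\phi,\widetilde F_\phi$ are computed for $(\widetilde g,\widetilde\phi,\lambda)$ with $m=n+2$. ''Locally conformally flat'' for a manifold with density means by definition that $g$ is flat. The cone. $\mathcal G$ is the set of triples $(x,g_x,l)$, $x\in M$, $l\in\mathbb R$, with projection $\pi$ to $M$, dilations $\delta_s(x,g_x,l)=(x,g_x,l+s)$,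 and $\boldsymbol g(X,Y)=g_x(\pi_*X,\pi_*Y)$, $\boldsymbol\phi(x,g_x,l)=l$. Identify $\mathcal G\cong\mathbb R\times M$ with coordinates $(v,x)$ by $l=\phi(x)-v$. On $\mathcal G\times\mathbb R$ use coordinates $(v,x,u)$, $\iota(z)=(z,0)$, and $\delta_s(v,x,u)=(v+(\lambda u-1)^{-1}s,x,u)$ near $u=0$. A pre-ambient space for $(M^n,g,[\phi],\lambda)$ is $(\widetilde{\mathcal G},\widetilde g,\widetilde\phi,\lambda)$ with: (i) $\widetilde{\mathcal G}$ a dilation-invariant neighborhood of $\mathcal G\times\{0\}$ in $\mathcal G\times\mathbb R$; (ii) $\widetilde g$ a smooth metric of signature $(n+1,1)$, $\widetilde\phi$ smooth; (iii) the components of $\widetilde g$ are independent of $v$, and $\delta_s^*\widetilde\phi=\widetilde\phi+s$, i.e. $\widetilde\phi=\phi_u-v+\lambda uv$ with $\phi_u$ independent of $v$; (iv) $(\iota^*\widetilde g,\iota^*\widetilde\phi)=(\boldsymbol g,\boldsymbol\phi)$; (v) $\widetilde\nabla_{\partial_v}\partial_v=0\bmod O(u)$. A weighted ambient space is a pre-ambient space with $\widetilde P_\phi=O(u^\infty)$ and $\widetilde F_\phi=O(u^\infty)$ at $u=0$. In the claim $\widetilde{\mathcal G}$ is such a neighborhood, on which $g_u$ is nondegenerate. *)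

(* Defs.v *)
From HB Require Import structures.
From mathcomp Require Import all_boot all_order all_algebra.
From mathcomp Require Import all_classical all_reals all_analysis.
Set Implicit Arguments.
Unset Strict Implicit.
Unset Printing Implicit Defensive.
Import Order.TTheory GRing.Theory Num.Theory.
Import numFieldNormedType.Exports.
Local Open Scope classical_set_scope.
Local Open Scope ring_scope.

Section Calculus.
Variables (R : realType) (m : nat).
Implicit Types (U : set 'rV[R]_m) (f : 'rV[R]_m -> R).

Definition partial (i : 'I_m) f : 'rV[R]_m -> R := 'D_(delta_mx ord0 i) f.

Fixpoint Ck_on (k : nat) U f : Prop :=
  (forall x, U x -> {for x, continuous f}) /\
  if k is k'.+1 then
    (forall i x, U x -> derivable f x (delta_mx ord0 i)) /\
    (forall i, Ck_on k' U (partial i f))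
  else True.

(* Meaningful for open U only. *)
Definition smooth_on U f : Prop := forall k, Ck_on k U f.

End Calculus.

(* Pseudo-Riemannian geometry in one coordinate system; [g x a b] is the
   component g_{ab} at x. *)
Section LocalGeometry.
Variables (R : realType) (m : nat).
Variable g : 'rV[R]_m -> 'M[R]_m.
Implicit Types (f : 'rV[R]_m -> R) (x : 'rV[R]_m).

Definition ginv x : 'M[R]_m := invmx (g x).

(* Gamma^k_{ij} *)
Definition christoffel (k i j : 'I_m) x : R :=
  2^-1 * \sum_l ginv x k l *
    (partial i (fun y => g y j l) x + partial j (fun y => g y i l) x
     - partial l (fun y => g y i j) x).

(* The d_l-component of R(d_i, d_j) d_k, where
   R(X, Y) Z = nabla_X nabla_Y Z - nabla_Y nabla_X Z - nabla_[X, Y] Z. *)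
Definition riemann (l k i j : 'I_m) x : R :=
  partial i (christoffel l j k) x - partial j (christoffel l i k) x
  + \sum_s (christoffel l i s x * christoffel s j k x
            - christoffel l j s x * christoffel s i k x).

(* Positive on round spheres: trace of X |-> R(X, d_j) d_k. *)
Definition ricci x : 'M[R]_m := \matrix_(j, k) \sum_i riemann i k i j x.

Definition scalar_curvature x : R :=
  \sum_i \sum_j ginv x i j * ricci x i j.

Definition hessian f x : 'M[R]_m :=
  \matrix_(i, j) (partial i (partial j f) x
                  - \sum_k christoffel k i j x * partial k f x).

Definition laplacian f x : R :=
  \sum_i \sum_j ginv x i j * hessian f x i j.

Definition grad_sqnorm f x : R :=
  \sum_i \sum_j ginv x i j * partial i f x * partial j f x.

Definition P_loc f (lambda : R) x : 'M[R]_m :=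
  ricci x + hessian f x - lambda *: g x.

Definition F_loc f (lambda : R) x : R :=
  laplacian f x - grad_sqnorm f x + 2 * lambda * f x - m%:R * lambda.

Definition Y_loc f (lambda : R) x : R :=
  - 2^-1 * (scalar_curvature x + grad_sqnorm f x - 2 * lambda * f x).

End LocalGeometry.

(* Raw data of an atlas on M modelled on R^m; the axioms are in
   [is_manifold].  [chart_param i] inverts [chart_coord i] on the image of
   [chart_dom i] and is junk elsewhere; [chart_at p] is a preferred chart
   around p. *)
Record atlas (R : realType) (m : nat) (M : Type) := Atlas {
  chart : Type;
  chart_dom : chart -> set M;
  chart_coord : chart -> M -> 'rV[R]_m;
  chart_param : chart -> 'rV[R]_m -> M;
  chart_at : M -> chart }.

Section Manifolds.
Variables (R : realType) (m : nat) (M : topologicalType) (A : atlas R m M).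

Definition chart_image (i : chart A) (W : set M) : set 'rV[R]_m :=
  chart_coord i @` (chart_dom i `&` W).

Definition transition (i j : chart A) : 'rV[R]_m -> 'rV[R]_m :=
  chart_coord j \o chart_param i.

Record is_manifold : Prop := IsManifold {
  mf_hausdorff : hausdorff_space M;
  mf_second_countable : @second_countable M;
  mf_chart_at : forall p, chart_dom (chart_at A p) p;
  mf_dom_open : forall i : chart A, open (chart_dom i);
  mf_image_open : forall i : chart A, open (chart_coord i @` chart_dom i);
  mf_coordK : forall (i : chart A) p,
    chart_dom i p -> chart_param i (chart_coord i p) = p;
  mf_coord_continuous : forall i : chart A,
    {within chart_dom i, continuous (chart_coord i)};
  mf_param_continuous : forall i : chart A,
    {within chart_coord i @` chart_dom i, continuous (chart_param i)};
  mf_transition_smooth : forall (i j : chart A) (a : 'I_m),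
    smooth_on (chart_image i (chart_dom j)) (fun x => transition i j x ord0 a) }.

(* f is a smooth function on the open set W. *)
Definition smooth_fun_on (W : set M) (f : M -> R) : Prop :=
  forall i : chart A, smooth_on (chart_image i W) (f \o chart_param i).

(* A covariant 2-tensor is given by its components in each chart. *)
Definition tensor2 : Type := chart A -> 'rV[R]_m -> 'M[R]_m.

(* ['J f x] acts on row vectors: its (a, c) entry is d_a f^c. *)
Definition tensorial_on (W : set M) (g : tensor2) : Prop :=
  forall (i j : chart A) p, W p -> chart_dom i p -> chart_dom j p ->
    let J := 'J (transition i j) (chart_coord i p) in
    g i (chart_coord i p) = J *m g j (chart_coord j p) *m J^T.

Definition smooth_tensor_on (W : set M) (g : tensor2) : Prop :=
  tensorial_on W g /\
  forall (i : chart A) (a b : 'I_m),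
    smooth_on (chart_image i W) (fun x => g i x a b).

End Manifolds.

Definition has_signature (R : realType) (m p q : nat) (B : 'M[R]_m) : Prop :=
  (p + q)%N = m /\
  exists2 S : 'M[R]_m, S \in unitmx &
    S *m B *m S^T = diag_mx (\row_(k < m) (if (k < p)%N then 1 else -1)).

Definition posdef (R : realType) (m : nat) (B : 'M[R]_m) : Prop :=
  forall w : 'rV[R]_m, w != 0 -> 0 < (w *m B *m w^T) ord0 ord0.

Section DensityManifolds.
Variables (R : realType) (n : nat) (M : topologicalType) (A : atlas R n M).
Variables (g : tensor2 A) (phi : M -> R) (lambda : R).

Record is_manifold_with_density : Prop := IsManifoldWithDensity {
  md_manifold : is_manifold A;
  md_connected : connected [set: M];
  md_metric_smooth : smooth_tensor_on setT g;
  md_metric_riemannian : forall (i : chart A) x, chart_image i setT x ->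
    (g i x)^T = g i x /\ posdef (g i x);
  md_phi_smooth : smooth_fun_on A setT phi }.

Definition P_phi : tensor2 A :=
  fun i => P_loc (g i) (phi \o chart_param i) lambda.

Definition Y_phi (p : M) : R :=
  let i := chart_at A p in
  Y_loc (g i) (phi \o chart_param i) lambda (chart_coord i p).

Definition gradient_ricci_soliton : Prop :=
  forall (i : chart A) x, chart_image i setT x -> P_phi i x = 0.

Definition is_flat : Prop :=
  forall (i : chart A) x, chart_image i setT x ->
  forall a b c d, riemann (g i) a b c d x = 0.

End DensityManifolds.

(* The cone.  A triple (x, g_x, l) is encoded as (x, l), g_x being determined
   by x. *)
Section Cone.
Variables (R : realType) (n : nat) (M : topologicalType) (A : atlas R n M).
Variables (g : tensor2 A) (phi : M -> R).

Definition cone : Type := (M * R)%type.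
Definition cone_phi (c : cone) : R := c.2.

(* The identification R x M ~ cone, l = phi(x) - v. *)
Definition cone_of_coord (y : R * M) : cone := (y.2, phi y.2 - y.1).

(* Components of g_x(pi_* X, pi_* Y) in the coordinates (v, x). *)
Definition cone_metric (i : chart A) (y : 'rV[R]_(1 + n)) : 'M[R]_(1 + n) :=
  block_mx 0 0 0 (g i (rsubmx y)).

End Cone.

(* Points of the ambient manifold R x M x R are z = (v, x, u), and the
   corresponding coordinate vectors are (v, x^1, ..., x^n, u). *)
Section Ambient.
Variables (R : realType) (n : nat) (M : topologicalType) (A : atlas R n M).

Definition ambient : topologicalType := (R * M * R)%type.

Definition v_coord (z : 'rV[R]_(1 + n + 1)) : R := lsubmx (lsubmx z) ord0 ord0.
Definition x_coord (z : 'rV[R]_(1 + n + 1)) : 'rV[R]_n := rsubmx (lsubmx z).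
Definition u_coord (z : 'rV[R]_(1 + n + 1)) : R := rsubmx z ord0 ord0.
Definition v_index : 'I_(1 + n + 1) := lshift 1 (lshift n ord0).

Definition ambient_atlas : atlas R (1 + n + 1) ambient :=
  @Atlas R (1 + n + 1) ambient (chart A)
    (fun i => [set z : ambient | chart_dom i z.1.2])
    (fun i (z : ambient) =>
       row_mx (row_mx (const_mx z.1.1) (chart_coord i z.1.2)) (const_mx z.2))
    (fun i z => (v_coord z, chart_param i (x_coord z), u_coord z))
    (fun z : ambient => chart_at A z.1.2).

(* Defined where lambda u != 1. *)
Definition dilation (lambda s : R) (z : ambient) : ambient :=
  (z.1.1 + (lambda * z.2 - 1)^-1 * s, z.1.2, z.2).

Record dilation_invariant_nbhd (lambda : R) (W : set ambient) : Prop :=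
  DilationInvariantNbhd {
  din_open : open W;
  din_cone : forall v x, W (v, x, 0);
  din_dilation_defined : forall z, W z -> lambda * z.2 != 1;
  din_dilation : forall s z, W z -> W (dilation lambda s z) }.

Definition O_u (N : nat) (D : set 'rV[R]_(1 + n + 1))
    (f : 'rV[R]_(1 + n + 1) -> R) : Prop :=
  forall z, D z -> u_coord z = 0 ->
    f =O_z (fun y => u_coord y ^+ N : R).

Definition O_u_infty (D : set 'rV[R]_(1 + n + 1))
    (f : 'rV[R]_(1 + n + 1) -> R) : Prop :=
  forall N, O_u N D f.

Variables (g : tensor2 A) (phi : M -> R) (lambda : R).
Variables (W : set ambient) (gt : tensor2 ambient_atlas) (phit : ambient -> R).

Local Notation img i := (chart_image (A := ambient_atlas) i W).

Record is_preambient_space : Prop := IsPreambientSpace {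
  pa_nbhd : dilation_invariant_nbhd lambda W;
  pa_metric_smooth : smooth_tensor_on W gt;
  pa_metric_signature : forall (i : chart A) z, img i z ->
    (gt i z)^T = gt i z /\ has_signature n.+1 1 (gt i z);
  pa_phi_smooth : smooth_fun_on ambient_atlas W phit;
  pa_metric_homogeneous : forall (i : chart A) z z', img i z -> img i z' ->
    x_coord z = x_coord z' -> u_coord z = u_coord z' -> gt i z = gt i z';
  pa_phi_homogeneous : forall s z, W z ->
    phit (dilation lambda s z) = phit z + s;
  pa_metric_initial : forall (i : chart A) z, img i z -> u_coord z = 0 ->
    ulsubmx (gt i z) = cone_metric g i (lsubmx z);
  pa_phi_initial : forall v x,
    phit (v, x, 0) = cone_phi (cone_of_coord phi (v, x));
  pa_normal : forall (i : chart A) k,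
    O_u 1 (img i) (christoffel (gt i) k v_index v_index) }.

Record is_weighted_ambient_space : Prop := IsWeightedAmbientSpace {
  wa_preambient : is_preambient_space;
  wa_P : forall (i : chart A) a b,
    O_u_infty (img i) (fun z => P_phi gt phit lambda i z a b);
  wa_F : forall i : chart A,
    O_u_infty (img i)
      (F_loc (gt i) (phit \o chart_param (a := ambient_atlas) i) lambda) }.

End Ambient.

Section Ansatz.
Variables (R : realType) (n : nat) (M : topologicalType) (A : atlas R n M).
Variables (g : tensor2 A) (phi : M -> R) (lambda : R).

Definition g_u (u : R) : tensor2 A := fun i x =>
  let P := P_phi g phi lambda i x in
  g i x + (2 * u) *: P + u ^+ 2 *: (P *m ginv (g i) x *m P).

Definition phi_u (u : R) (p : M) : R := phi p - u * Y_phi g phi lambda p.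

(* 2 du dv = du (x) dv + dv (x) du *)
Definition g_tilde : tensor2 (ambient_atlas A) := fun i z =>
  block_mx (block_mx 0 0 0 (g_u (u_coord z) i (x_coord z)))
           (col_mx (1 : 'M[R]_1) 0) (row_mx (1 : 'M[R]_1) 0) 0.

Definition phi_tilde (z : ambient R M) : R :=
  phi_u z.2 z.1.2 - z.1.1 + lambda * z.2 * z.1.1.

Definition g_u_nondegenerate_on (W : set (ambient R M)) : Prop :=
  forall (i : chart A) v x u, W (v, x, u) -> chart_dom i x ->
    g_u u i (chart_coord i x) \in unitmx.

End Ansatz.

(* Main.v *)
From HB Require Import structures.
Require Import Defs.
From mathcomp Require Import all_boot all_order all_algebra.
From mathcomp Require Import all_classical all_reals all_analysis.
From mathcomp Require Import ring lra.
Set Implicit Arguments.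
Unset Strict Implicit.
Unset Printing Implicit Defensive.
Import Order.TTheory GRing.Theory Num.Theory.
Import numFieldNormedType.Exports.
Local Open Scope ring_scope.

(** Write A = g + u P and B = A g^-1, so that g_u = A g^-1 A = B g B^T.  The
    differential of phi_u is B dphi, because dY = - P g^-1 dphi: for a soliton
    this is Hamilton's identity (from the contracted second Bianchi identity),
    for a flat metric it is immediate.  Moreover P g^-1 is a Codazzi tensor, so
    the Levi-Civita connection of g_u is the gauge transform by B of the one of
    g, and its curvature is B R B^-1.  As either B = 1 or R = 0, Ricci and
    Hessian of the ambient metric can be written down explicitly, and the
    ambient P and F vanish identically, not just to infinite order at u = 0.

    Local geometry is algebra in the commutative ring of smooth functions on a
    chart, equipped with the commuting derivations d_i.  The Ricci tensor is
    lambda g - Hess phi or 0, so among second-order objects only the Hessian has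
    to be shown independent of the chart. *)

(** * Derivations and connections on a commutative ring *)

(** Smooth functions on a chart form a ring with zero divisors and many non-units, so nothing is
    divided: one half is an element [h] with [h + h = 1], and the inverses of g and B are carried
    along as matrices [gi] and [C]. The matrix [C] exists because g_u = B g B^T is nondegenerate,
    which makes B invertible at every point.

    The ambient connection is not computed from the Christoffel formula. It is written down, shown
    to be metric and torsion free, and then identified by uniqueness; the same uniqueness gives the
    law by which a connection changes with the chart. Compatibility with the metric survives a gauge
    transform automatically, so the content lies in the absence of torsion, and that is what the
    Codazzi property supplies.

    Y is defined at each point in the preferred chart of that point. Hence its invariance is needed
    even for a statement inside one fixed chart. *)

Record derivations (S : comPzRingType) (m : nat) := Derivations {
  der :> 'I_m -> S -> S;
  derD : forall i, {morph der i : a b / a + b};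
  derM : forall i a b, der i (a * b) = der i a * b + a * der i b;
  derC : forall i j a, der i (der j a) = der j (der i a) }.

Ltac mx_normalize :=
  rewrite ?(mulmxDl, mulmxDr, mulmxBl, mulmxBr, mulmxN, mulNmx, mulmxA,
            mul1mx, mulmx1, mul0mx, mulmx0).

(** For identities that are linear in noncommutative words: after full distribution the matrix
    products are generalized to opaque matrices, so that entrywise [ring] only has to compare linear
    combinations. *)
Ltac mx_linear :=
  mx_normalize;
  repeat match goal with |- context [@mulmx ?S ?m ?n ?p ?A ?B] =>
    move: (@mulmx S m n p A B) end;
  intros; apply/matrixP => ? ?; rewrite !mxE; ring.

Section Derivations.
Variables (S : comPzRingType) (m : nat) (D : derivations S m).
Implicit Types (i j k : 'I_m) (a b : S).

Lemma der0 i : D i 0 = 0.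
Proof. by apply: (addrI (D i 0)); rewrite -derD !addr0. Qed.

Lemma derN i : {morph D i : a / - a}.
Proof. by move=> a; apply: (addrI (D i a)); rewrite -derD !subrr der0. Qed.

Lemma derB i : {morph D i : a b / a - b}.
Proof. by move=> a b; rewrite derD derN. Qed.

Lemma der1 i : D i 1 = 0.
Proof.
have := derM D i 1 1; rewrite !mulr1 mul1r => h.
by apply: (addrI (D i 1)); rewrite -h addr0.
Qed.

Lemma der_sum i I (r : seq I) (P : pred I) (F : I -> S) :
  D i (\sum_(k <- r | P k) F k) = \sum_(k <- r | P k) D i (F k).
Proof. exact: (big_morph (D i) (derD D i) (der0 i)). Qed.

(** Twice the derivative vanishes, and multiplying by 1 = h + h removes the factor 2 without a
    division. *)
Lemma der_half i h : h + h = 1 -> D i h = 0.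
Proof.
move=> h2; have e : D i h + D i h = 0 by rewrite -derD h2 der1.
by rewrite -[LHS]mul1r -h2 mulrDl -mulrDr e mulr0.
Qed.

Definition dmx i p q (A : 'M[S]_(p, q)) : 'M[S]_(p, q) := map_mx (D i) A.

Lemma dmxE i p q (A : 'M[S]_(p, q)) s t : dmx i A s t = D i (A s t).
Proof. by rewrite mxE. Qed.

Lemma dmxD i p q (A B : 'M[S]_(p, q)) : dmx i (A + B) = dmx i A + dmx i B.
Proof. by apply/matrixP => s t; rewrite !mxE derD. Qed.

Lemma dmxN i p q (A : 'M[S]_(p, q)) : dmx i (- A) = - dmx i A.
Proof. by apply/matrixP => s t; rewrite !mxE derN. Qed.

Lemma dmxB i p q (A B : 'M[S]_(p, q)) : dmx i (A - B) = dmx i A - dmx i B.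
Proof. by rewrite dmxD dmxN. Qed.

Lemma dmxM i p q r (A : 'M[S]_(p, q)) (B : 'M[S]_(q, r)) :
  dmx i (A *m B) = dmx i A *m B + A *m dmx i B.
Proof.
apply/matrixP => s t; rewrite !mxE der_sum -big_split /=.
by apply: eq_bigr => k _; rewrite derM !mxE.
Qed.

Lemma dmxZ i p q a (A : 'M[S]_(p, q)) :
  dmx i (a *: A) = D i a *: A + a *: dmx i A.
Proof. by apply/matrixP => s t; rewrite !mxE derM. Qed.

Lemma dmx_zero i p q : dmx i (0 : 'M[S]_(p, q)) = 0.
Proof. by apply/matrixP => s t; rewrite !mxE der0. Qed.

Lemma dmxC i j p q (A : 'M[S]_(p, q)) : dmx i (dmx j A) = dmx j (dmx i A).
Proof. by apply/matrixP => s t; rewrite !mxE derC. Qed.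

Lemma dmx_tr i p q (A : 'M[S]_(p, q)) : dmx i A^T = (dmx i A)^T.
Proof. by apply/matrixP => s t; rewrite !mxE. Qed.

Lemma dmx_row i p q (A : 'M[S]_(p, q)) s : dmx i (row s A) = row s (dmx i A).
Proof. by apply/matrixP => k t; rewrite !mxE. Qed.

Lemma dmx1 i p : dmx i (1%:M : 'M[S]_p) = 0.
Proof.
by apply/matrixP => s t; rewrite !mxE; case: eqP => _; rewrite ?der1 ?der0.
Qed.

Lemma dmx_inv i p (B C : 'M[S]_p) :
  B *m C = 1%:M -> dmx i C = - (C *m dmx i B *m C).
Proof.
move=> BC; have CB := mulmx1C BC.
have : C *m dmx i (B *m C) = 0 by rewrite BC dmx1 mulmx0.
by rewrite dmxM mulmxDr !mulmxA CB mul1mx addrC => /eqP; rewrite addr_eq0 => /eqP.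
Qed.

(* [G i j k] is the Christoffel symbol with upper index k and lower indices
   i, j, so that [G i] acts on row vectors: nabla_i X = D_i X + X *m G i. *)
Implicit Types (G : 'I_m -> 'M[S]_m) (g : 'M[S]_m).

Definition torsion_free G := forall i j k, G i j k = G j i k.

Definition metric_compat G g :=
  forall i, dmx i g = G i *m g + g *m (G i)^T.

(** The commutator [nabla_i, nabla_j] as an endomorphism of row vectors. The connection matrices act
    from the right, which reverses the usual order of the two products; entry (k, l) is the
    l-component of R(d_i, d_j) d_k. *)
Definition curv G i j : 'M[S]_m :=
  dmx i (G j) - dmx j (G i) + G j *m G i - G i *m G j.

Definition ric G : 'M[S]_m := \matrix_(j, k) \sum_i curv G i j k i.

Definition dcol a : 'cV[S]_m := \col_i D i a.

Definition hess G a : 'M[S]_m :=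
  \matrix_(i, j) (D i (D j a) - \sum_k G i j k * D k a).

Definition christ h gi g k i j : S :=
  h * \sum_l gi k l * (D i (g j l) + D j (g i l) - D l (g i j)).

Definition christ_conn h gi g i : 'M[S]_m := \matrix_(j, k) christ h gi g k i j.

Lemma inv_sym p (gi g : 'M[S]_p) : gi *m g = 1%:M -> g^T = g -> gi^T = gi.
Proof.
move=> gig gT; have h : gi^T *m g = 1%:M.
  by rewrite -[X in _ *m X]gT -trmx_mul (mulmx1C gig) trmx1.
rewrite -[gi^T]mulmx1 -(mulmx1C gig) mulmxA h mul1mx //.
Qed.

Lemma symE p (g : 'M[S]_p) : g^T = g -> forall s t, g s t = g t s.
Proof. by move=> gT s t; rewrite -{1}gT mxE. Qed.

(** Koszul's argument: with the upper index lowered, compatibility writes each derivative of g as a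
    sum of two symbols, and symmetry in the lower indices cancels all but twice one of them. *)
Lemma christ_unique h gi g G : h + h = 1 -> gi *m g = 1%:M -> g^T = g ->
  torsion_free G -> metric_compat G g ->
  forall i j k, christ h gi g k i j = G i j k.
Proof.
move=> h2 gig gT tf mc i j k; have giE := symE (inv_sym gig gT).
pose L i := G i *m g.
have dg s l t : D s (g l t) = L s l t + L s t l.
  rewrite -dmxE mc !mxE; congr (_ + _); apply: eq_bigr => r _.
  by rewrite !mxE mulrC (symE gT).
have Lsym r s t : L r s t = L s r t.
  by rewrite !mxE; apply: eq_bigr => l _; rewrite tf.
have -> : G i j k = (L i *m gi) j k by rewrite -mulmxA (mulmx1C gig) mulmx1.
rewrite /christ [RHS]mxE mulr_sumr; apply: eq_bigr => l _.
rewrite !dg (Lsym l i) (Lsym l j) (Lsym j i) (giE k l).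
rewrite -[RHS]mulr1 -h2; ring.
Qed.

Lemma christ_torsion_free h gi g : g^T = g -> torsion_free (christ_conn h gi g).
Proof.
move=> gT i j k; rewrite !mxE; congr (_ * _); apply: eq_bigr => l _.
by rewrite (symE gT i j); ring.
Qed.

Lemma christ_metric_compat h gi g : h + h = 1 -> gi *m g = 1%:M -> g^T = g ->
  metric_compat (christ_conn h gi g) g.
Proof.
move=> h2 gig gT i; have giE := symE (inv_sym gig gT).
pose F : 'M[S]_m :=
  \matrix_(j, k) (h * (D i (g j k) + D j (g i k) - D k (g i j))).
have -> : christ_conn h gi g i = F *m gi.
  apply/matrixP => j k; rewrite !mxE /christ mulr_sumr; apply: eq_bigr => l _.
  by rewrite !mxE giE; ring.
rewrite trmx_mul (inv_sym gig gT) mulmxA (mulmx1C gig) mul1mx -mulmxA gig mulmx1.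
apply/matrixP => s t; rewrite !mxE (symE gT t s) -[LHS]mul1r -h2; ring.
Qed.

Lemma curvE G i j k l : curv G i j k l = D i (G j k l) - D j (G i k l)
  + \sum_s G j k s * G i s l - \sum_s G i k s * G j s l.
Proof. by rewrite /curv !mxE. Qed.

Lemma curvN G i j : curv G i j = - curv G j i.
Proof. by rewrite /curv; mx_linear. Qed.

(** The commutator of two derivations kills g; expanded by compatibility, this says that the lowered
    curvature is antisymmetric. *)
Lemma curv_metric G g : metric_compat G g ->
  forall i j, curv G i j *m g + g *m (curv G i j)^T = 0.
Proof.
move=> mc i j; have := dmxC i j g.
rewrite (mc j) (mc i) !(dmxD, dmxM) !dmx_tr (mc j) (mc i) => /eqP.
rewrite -subr_eq0 => /eqP E; apply: etrans E.
by rewrite /curv !(raddfD, raddfN) /= !trmx_mul; mx_linear.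
Qed.

(** The covariant derivative of the curvature in its endomorphism indices only. For a torsion-free
    connection the terms for the form indices i, j cancel in the cyclic sum, so they are left out
    from the start. *)
Definition bianchi_term G k i j : 'M[S]_m :=
  dmx k (curv G i j) + curv G i j *m G k - G k *m curv G i j.

Lemma bianchi2 G i j k :
  bianchi_term G k i j + bianchi_term G i j k + bianchi_term G j k i = 0.
Proof.
rewrite /bianchi_term /curv !(dmxD, dmxN, dmxM).
rewrite (dmxC k i) (dmxC k j) (dmxC i j).
mx_linear.
Qed.

Lemma hessE G a i j : hess G a i j = (dmx i (dcol a) - G i *m dcol a) j 0.
Proof.
rewrite !mxE; congr (_ - _); apply: eq_bigr => k _; by rewrite !mxE.
Qed.

Lemma hess_sym G a : torsion_free G -> (hess G a)^T = hess G a.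
Proof.
move=> tf; apply/matrixP => i j; rewrite !mxE derC; congr (_ - _).
by apply: eq_bigr => k _; rewrite tf.
Qed.

(** [Gi'] is the same connection after the change of frame B, under which g becomes B g B^T. Torsion
    is not preserved by such a change and is treated separately at each use. *)
Lemma gauge_compat i (B C g : 'M[S]_m) (Gi : 'M[S]_m) : C *m B = 1%:M ->
  dmx i g = Gi *m g + g *m Gi^T ->
  let Gi' := (dmx i B + B *m Gi) *m C in
  dmx i (B *m g *m B^T) = Gi' *m (B *m g *m B^T) + (B *m g *m B^T) *m Gi'^T.
Proof.
move=> CB mc /=; rewrite !dmxM mc dmx_tr.
have -> X : X *m C *m (B *m g *m B^T) = X *m g *m B^T.
  by rewrite -!mulmxA [C *m _]mulmxA CB mul1mx.
have -> X : (B *m g *m B^T) *m (X *m C)^T = B *m g *m X^T.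
  by rewrite trmx_mul -!mulmxA [B^T *m _]mulmxA -trmx_mul CB trmx1 mul1mx.
rewrite [(_ + _)^T]raddfD /= trmx_mul; mx_linear.
Qed.

Lemma gauge_curv (B C : 'M[S]_m) G i j : C *m B = 1%:M ->
  curv (fun i => (dmx i B + B *m G i) *m C) i j = B *m curv G i j *m C.
Proof.
move=> CB; rewrite /curv !(dmxD, dmxN, dmxM) !(dmx_inv _ (mulmx1C CB)) (dmxC j i).
have cancel X Y : X *m C *m B *m Y = X *m Y by rewrite -(mulmxA X) CB mulmx1.
rewrite ?(mulmxDl, mulmxDr, mulmxBl, mulmxBr, mulmxN, mulNmx, mulmxA) !cancel.
mx_linear.
Qed.

End Derivations.

(** * Contracted Bianchi identity, Ricci identity and the gradient of Y *)

Section Bianchi.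
Variables (S : comPzRingType) (m : nat) (D : derivations S m).
Variables (h : S) (G : 'I_m -> 'M[S]_m) (g gi : 'M[S]_m).
Hypotheses (h2 : h + h = 1) (gT : g^T = g) (gig : gi *m g = 1%:M).
Hypotheses (tf : torsion_free G) (mc : metric_compat D G g).
Implicit Types (i j k s : 'I_m) (a lam : S).

Definition scal : S := \sum_i \sum_j gi i j * ric D G i j.

Lemma eq_opp_eq0 (x : S) : x = - x -> x = 0.
Proof.
move=> e; rewrite -[x]mul1r -h2 mulrDl.
by rewrite {1}e mulrN addNr.
Qed.

Lemma dmx_metric_inv i : dmx D i gi = - (gi *m G i + (G i)^T *m gi).
Proof.
rewrite (dmx_inv _ _ (mulmx1C gig)) mc mulmxDr mulmxDl.
rewrite mulmxA -[_ *m g *m gi]mulmxA (mulmx1C gig) mulmx1.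
by rewrite [gi *m (g *m _)]mulmxA gig mul1mx.
Qed.

Lemma sym_antisym_contract (a b : 'I_m -> 'I_m -> S) :
  (forall i s, a i s = a s i) -> (forall i s, b i s = - b s i) ->
  \sum_i \sum_s a i s * b s i = 0.
Proof.
move=> aS bA; apply: eq_opp_eq0; rewrite [LHS]exchange_big -sumrN.
apply: eq_bigr => i _; rewrite -sumrN; apply: eq_bigr => s _.
by rewrite aS bA mulrN.
Qed.

Let Ric := ric D G *m gi.
Let Psi i j := gi *m curv D G i j.

(** The right-hand side is twice the divergence of the mixed Ricci tensor. Tracing the second
    Bianchi identity twice, one cyclic term yields the derivative of the scalar curvature and each
    of the other two yields minus the divergence. *)
Lemma contracted_bianchi k :
  D k scal = (\sum_j (D j (Ric k j) + \sum_s Ric k s * G j s j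
                      - \sum_s Ric j s * G k s j)) *+ 2.
Proof.
have giT := inv_sym gig gT.
have PsiN i j s t : Psi i j s t = - Psi j i s t.
  by rewrite /Psi curvN mulmxN mxE.
have PsiA i j s t : Psi i j s t = - Psi i j t s.
  have e : Psi i j + (Psi i j)^T = 0.
    have := congr1 (fun X => gi *m X *m gi) (curv_metric mc i j).
    rewrite mulmx0 mul0mx mulmxDr mulmxDl => e; apply: etrans e.
    rewrite /Psi trmx_mul giT !mulmxA gig mul1mx; congr (_ + _).
    by rewrite -[RHS]mulmxA (mulmx1C gig) mulmx1.
  by have /eqP := congr1 (fun X : 'M[S]_m => X s t) e; rewrite !mxE addr_eq0 => /eqP.
(* The four traces that occur; antisymmetry in either pair of indices reduces the other three to
   this one. *)
have F1 l j : \sum_i Psi i l j i = Ric l j.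
  rewrite /Ric !mxE; under eq_bigr do rewrite mxE.
  rewrite exchange_big; apply: eq_bigr => s _ /=.
  by rewrite mxE -mulr_sumr mulrC (symE giT).
have F2 l j : \sum_i Psi l i i j = Ric l j.
  by rewrite -F1; apply: eq_bigr => i _; rewrite PsiN PsiA opprK.
have F3 l j : \sum_i Psi i l i j = - Ric l j.
  by rewrite -F1 -sumrN; apply: eq_bigr => i _; rewrite PsiA.
have F4 l j : \sum_i Psi l i j i = - Ric l j.
  by rewrite -F1 -sumrN; apply: eq_bigr => i _; rewrite PsiN.
have scalE : scal = \sum_i \sum_j Psi i j j i.
  rewrite [RHS]exchange_big; apply: eq_bigr => i _ /=; rewrite F1 mxE.
  by apply: eq_bigr => j _; rewrite mulrC (symE giT).
(* The Bianchi term with one index raised; raising commutes with it because [gi] is parallel. *)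
pose BT l i j := dmx D l (Psi i j) + (G l)^T *m Psi i j + Psi i j *m G l.
have BTE l i j : BT l i j = gi *m bianchi_term D G l i j.
  rewrite /BT /bianchi_term /Psi dmxM dmx_metric_inv; mx_linear.
have cyc i j : BT k i j j i + BT i j k j i + BT j k i j i = 0.
  rewrite !BTE; have := congr1 (fun X => (gi *m X) j i) (bianchi2 D G i j k).
  by rewrite mulmx0 !mulmxDr !mxE.
have : \sum_i \sum_j (BT k i j j i + BT i j k j i + BT j k i j i) = 0.
  by rewrite big1 // => i _; rewrite big1 // => j _.
have BTs l i j s t : BT l i j s t = D l (Psi i j s t)
   + \sum_r G l r s * Psi i j r t + \sum_r Psi i j s r * G l r t.
  by rewrite !mxE; do 2 congr (_ + _); apply: eq_bigr => r _; rewrite !mxE.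
under eq_bigr do rewrite !big_split /=.
rewrite !big_split /=.
have -> : \sum_i \sum_j BT k i j j i =
   D k scal + (\sum_j \sum_s Ric j s * G k s j) *+ 2.
  under eq_bigr do under eq_bigr do rewrite BTs.
  under eq_bigr do rewrite !big_split /=.
  rewrite !big_split /= -addrA mulr2n; congr (_ + (_ + _)).
  - by rewrite scalE der_sum; apply: eq_bigr => i _; rewrite der_sum.
  - rewrite exchange_big /=.
    under eq_bigr do rewrite exchange_big /=.
    apply: eq_bigr => j _; apply: eq_bigr => s _.
    by rewrite -mulr_sumr F1 mulrC.
  - apply: eq_bigr => i _; rewrite exchange_big; apply: eq_bigr => s _ /=.
    by rewrite -mulr_suml F2.
have -> : \sum_i \sum_j BT i j k j i =
   - \sum_j (D j (Ric k j) + \sum_s Ric k s * G j s j).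
  under eq_bigr do under eq_bigr do rewrite BTs.
  under eq_bigr do rewrite !big_split /=.
  rewrite !big_split /= opprD -!sumrN; congr (_ + _); last first.
    by apply: eq_bigr => i _; rewrite exchange_big -sumrN;
       apply: eq_bigr => s _ /=; rewrite -mulr_suml F3 mulNr.
  (* The Christoffel symbols are symmetric in the two contracted indices and the raised curvature is
     antisymmetric in them. *)
  rewrite [X in _ + X]exchange_big [X in _ + X]big1 ?addr0 => [|j _]; last first.
    apply: (sym_antisym_contract (a := fun i s => G i s j)) => i s; first exact: tf.
    exact: PsiA.
  by apply: eq_bigr => i _; rewrite -der_sum F3 derN.
have -> : \sum_i \sum_j BT j k i j i =
   - \sum_j (D j (Ric k j) + \sum_s Ric k s * G j s j).
  rewrite exchange_big /=.
  under eq_bigr do under eq_bigr do rewrite BTs.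
  under eq_bigr do rewrite !big_split /=.
  rewrite !big_split /= opprD -!sumrN -addrA [X in _ + X]addrC addrA; congr (_ + _);
    last first.
    apply: eq_bigr => j _; rewrite exchange_big -sumrN.
    by apply: eq_bigr => s _ /=; rewrite -mulr_sumr F4 mulrN mulrC.
  rewrite [X in _ + X]exchange_big [X in _ + X]big1 ?addr0 => [|i _].
    by apply: eq_bigr => i _; rewrite -der_sum F4 derN.
  under eq_bigr do under eq_bigr do rewrite mulrC.
  apply: (sym_antisym_contract (a := fun j s => G j s i)) => j s; first exact: tf.
  exact: PsiA.
rewrite !big_split /= sumrN.
set x := \sum_i D i _; set y := \sum_i \sum_s _ * G i s i.
set z := \sum_i \sum_s _ => e.
by rewrite -[LHS]addr0 -[X in _ + X]oppr0 -e; ring.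
Qed.

(** As [gi] is parallel, the raised Hessian is the covariant derivative of the gradient vector
    [(dcol D a)^T *m gi]. *)
Lemma hess_raise a i :
  dmx D i ((dcol D a)^T *m gi) + (dcol D a)^T *m gi *m G i
  = row i (hess D G a *m gi).
Proof.
have -> : row i (hess D G a *m gi) = (dmx D i (dcol D a) - G i *m dcol D a)^T *m gi.
  rewrite row_mul; congr (_ *m _); apply/matrixP => s t.
  by rewrite mxE hessE ord1 [RHS]mxE.
rewrite dmxM dmx_metric_inv dmx_tr raddfB /= trmx_mul; mx_linear.
Qed.

(* The exterior covariant derivative of M, seen as a vector-valued 1-form. *)
Definition codazzi (M : 'M[S]_m) i j : 'rV[S]_m :=
  dmx D j (row i M) + row i M *m G j - (dmx D i (row j M) + row j M *m G i).

Lemma codazziB (M N : 'M[S]_m) i j :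
  codazzi (M - N) i j = codazzi M i j - codazzi N i j.
Proof. by rewrite /codazzi !raddfB /= !dmxB; mx_linear. Qed.

(** The exterior covariant derivative of the identity is the torsion. *)
Lemma codazzi_scalar lam i j : (forall k, D k lam = 0) -> codazzi lam%:M i j = 0.
Proof.
move=> lam0; rewrite /codazzi -scalemx1 !linearZ /= !dmxZ !lam0 !dmx_row !dmx1.
rewrite -!scalemxAl -!row_mul !mul1mx.
apply/matrixP => s t; by rewrite !mxE (tf i j) !mul0r subrr.
Qed.

(** Ricci identity: the antisymmetrized second covariant derivative of the gradient is the curvature
    applied to it. *)
Lemma codazzi_hess a i j :
  codazzi (hess D G a *m gi) i j = (dcol D a)^T *m gi *m curv D G j i.
Proof.
rewrite /codazzi -!hess_raise /curv; move: (_ *m gi) => X.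
rewrite !(dmxD, dmxM) (dmxC D i j); mx_linear.
Qed.

Definition gsq a : S := \sum_i \sum_j gi i j * D i a * D j a.

Lemma gsqE a : gsq a = ((dcol D a)^T *m gi *m dcol D a) 0 0.
Proof.
rewrite /gsq exchange_big mxE; apply: eq_bigr => j _ /=.
rewrite !mxE mulr_suml; apply: eq_bigr => i _; rewrite !mxE; ring.
Qed.

Lemma der_gsq a i : D i (gsq a) = (hess D G a *m gi *m dcol D a) i 0 *+ 2.
Proof.
have giT := inv_sym gig gT.
rewrite gsqE -dmxE dmxM.
have -> : dmx D i ((dcol D a)^T *m gi) =
    row i (hess D G a *m gi) - (dcol D a)^T *m gi *m G i.
  by rewrite -hess_raise addrK.
have -> : (row i (hess D G a *m gi) - (dcol D a)^T *m gi *m G i) *m dcol D a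
   + (dcol D a)^T *m gi *m dmx D i (dcol D a) =
  row i (hess D G a *m gi) *m dcol D a
   + (dcol D a)^T *m gi *m (dmx D i (dcol D a) - G i *m dcol D a).
  mx_linear.
have -> : dmx D i (dcol D a) - G i *m dcol D a = (row i (hess D G a))^T.
  by apply/matrixP => s t; rewrite [RHS]mxE [RHS]mxE hessE ord1.
rewrite mulr2n [LHS]mxE -row_mul [X in X + _]mxE; congr (_ + _).
have -> : (dcol D a)^T *m gi *m (row i (hess D G a))^T =
   (row i (hess D G a) *m gi *m dcol D a)^T.
  by rewrite !trmx_mul giT mulmxA.
by rewrite mxE -!row_mul mxE.
Qed.

Definition Pmx lam a : 'M[S]_m := ric D G + hess D G a - lam *: g.

Lemma PmxE lam a i j :
  Pmx lam a i j = ric D G i j + hess D G a i j - lam * g i j.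
Proof. by rewrite /Pmx; move: (ric D G) (hess D G a) => A B; rewrite !mxE. Qed.

Definition Ypot lam a : S := - h * (scal + gsq a - 2 * lam * a).

Lemma half_mulr2n (x : S) : h * (x *+ 2) = x.
Proof. by rewrite -[RHS]mul1r -h2; ring. Qed.

(** The hypothesis on [scal] is the only input that differs between the two cases: for a flat metric
    both of its sides vanish, for a soliton it is Hamilton's identity. *)
Lemma grad_Y lam a : (forall k, D k lam = 0) ->
  (forall k, D k scal = (ric D G *m gi *m dcol D a) k 0 *+ 2) ->
  dcol D (Ypot lam a) = - (Pmx lam a *m gi *m dcol D a).
Proof.
move=> lam0 dscal; apply/matrixP => i j; rewrite ord1 mxE.
have -> : Pmx lam a *m gi *m dcol D a =
    ric D G *m gi *m dcol D a + hess D G a *m gi *m dcol D a - lam *: dcol D a.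
  rewrite !(mulmxDl, mulNmx) -[lam *: g *m gi]scalemxAl (mulmx1C gig).
  by rewrite -[_ *: 1%:M *m _]scalemxAl mul1mx.
have two0 : D i 2 = 0 by rewrite -[2]/(1 + 1) derD der1 addr0.
rewrite /Ypot derM derN (der_half D i h2) derB derD dscal der_gsq !derM lam0 two0.
move: (_ *m dcol D a) (_ *m dcol D a) => y x; rewrite !mxE.
have -> : x i 0 + y i 0 - lam * D i a =
  h * (x i 0 *+ 2 + y i 0 *+ 2 - 2 * lam * D i a).
  by rewrite -[LHS]half_mulr2n; ring.
ring.
Qed.

Lemma flat_grad_scal a : (forall i j, curv D G i j = 0) ->
  forall k, D k scal = (ric D G *m gi *m dcol D a) k 0 *+ 2.
Proof.
move=> fl; have r0 : ric D G = 0.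
  by apply/matrixP => i j; rewrite !mxE big1 // => s _; rewrite fl mxE.
move=> k; rewrite /scal r0 !mul0mx mxE mul0rn big1 ?der0 // => i _.
by rewrite big1 // => j _; rewrite mxE mulr0.
Qed.

(** On a soliton the raised Hessian is lam - Ric, so the Ricci identity becomes a formula for the
    exterior covariant derivative of Ric. Its trace is div Ric - d scal on one side and - Ric(grad
    a) on the other; the contracted Bianchi identity d scal = 2 div Ric then gives d scal = 2
    Ric(grad a). *)
Lemma soliton_grad_scal lam a : (forall k, D k lam = 0) -> Pmx lam a = 0 ->
  forall k, D k scal = (ric D G *m gi *m dcol D a) k 0 *+ 2.
Proof.
move=> lam0 P0 k.
have hE : hess D G a *m gi = lam%:M - Ric.
  have /eqP := P0; rewrite /Pmx subr_eq0 => /eqP e.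
  rewrite -scalemx1 -(mulmx1C gig) scalemxAl -e mulmxDl /Ric; mx_linear.
have e j : codazzi Ric k j 0 j = - ((dcol D a)^T *m gi *m curv D G j k) 0 j.
  by rewrite -codazzi_hess hE codazziB codazzi_scalar // sub0r [X in - X]mxE opprK.
have : \sum_j codazzi Ric k j 0 j = - (ric D G *m gi *m dcol D a) k 0.
  under eq_bigr do rewrite e.
  rewrite sumrN; congr (- _).
  have -> : ric D G *m gi *m dcol D a = ric D G *m ((dcol D a)^T *m gi)^T.
    by rewrite trmx_mul trmxK (inv_sym gig gT) mulmxA.
  rewrite [RHS]mxE; under eq_bigr do rewrite mxE.
  rewrite exchange_big; apply: eq_bigr => s _ /=.
  by rewrite -mulr_sumr [ric _ _ _ _]mxE [_^T _ _]mxE mulrC.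
have -> : \sum_j codazzi Ric k j 0 j =
  \sum_j (D j (Ric k j) + \sum_s Ric k s * G j s j
          - \sum_s Ric j s * G k s j) - D k scal.
  rewrite /scal.
  have -> : \sum_i \sum_j gi i j * ric D G i j = \sum_j Ric j j.
    apply: eq_bigr => i _; rewrite [RHS]mxE; apply: eq_bigr => j _.
    by rewrite mulrC (symE (inv_sym gig gT)).
  rewrite der_sum -sumrB; apply: eq_bigr => j _.
  rewrite /codazzi; move: Ric => Q; rewrite !mxE.
  under [X in _ + X - _]eq_bigr do rewrite mxE.
  under [X in _ - (_ + X)]eq_bigr do rewrite mxE.
  ring.
have := contracted_bianchi k; rewrite -/Ric.
set E := \sum_j (_ - _) => -> eE.
by congr (_ *+ 2); apply: oppr_inj; rewrite -eE; ring.
Qed.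

End Bianchi.

(** * The ambient connection *)

Section AmbientIndices.
Variable n : nat.

(** Ambient matrices are tabulated by the kinds of their indices, which turns block identities into
    a finite case analysis. *)
Variant ambient_kind := KindV | KindX of 'I_n | KindU.

Definition kind_of (b : 'I_(1 + n + 1)) : ambient_kind :=
  match fintype.split b with
  | inl c => match fintype.split c with inl _ => KindV | inr i => KindX i end
  | inr _ => KindU
  end.

Definition vI : 'I_(1 + n + 1) := lshift 1 (lshift n ord0).
Definition xI (i : 'I_n) : 'I_(1 + n + 1) := lshift 1 (rshift 1 i).
Definition uI : 'I_(1 + n + 1) := rshift (1 + n) ord0.

Lemma kind_v : kind_of vI = KindV.
Proof.
rewrite /kind_of /vI -[lshift 1 _]/(fintype.unsplit (inl _)) fintype.unsplitK.
by rewrite -[lshift n _]/(fintype.unsplit (inl _)) fintype.unsplitK.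
Qed.

Lemma kind_x i : kind_of (xI i) = KindX i.
Proof.
rewrite /kind_of /xI -[lshift 1 _]/(fintype.unsplit (inl _)) fintype.unsplitK.
by rewrite -[rshift 1 _]/(fintype.unsplit (inr _)) fintype.unsplitK.
Qed.

Lemma kind_u : kind_of uI = KindU.
Proof. by rewrite /kind_of /uI -[rshift _ _]/(fintype.unsplit (inr _))
  fintype.unsplitK. Qed.

Lemma ambient_index_ind (P : 'I_(1 + n + 1) -> Prop) :
  P vI -> (forall i, P (xI i)) -> P uI -> forall b, P b.
Proof.
move=> Pv Px Pu b; rewrite -(fintype.splitK b); case: (fintype.split b) => [c|c] /=.
  by rewrite -(fintype.splitK c); case: (fintype.split c) => [c0|k]; [rewrite (ord1
    c0)|exact: Px].
by rewrite (ord1 c).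
Qed.

Lemma ambient_sum (V : nmodType) (F : 'I_(1 + n + 1) -> V) :
  \sum_b F b = F vI + \sum_i F (xI i) + F uI.
Proof. by rewrite !big_split_ord /= !big_ord1. Qed.

(** The Gram matrix of 2 du dv + A. Since the hyperbolic block is its own inverse, inverse ambient
    metrics have this shape too. *)
Definition ambient_mx (S : pzSemiRingType) (A : 'M[S]_n) : 'M[S]_(1 + n + 1) :=
  block_mx (block_mx 0 0 0 A) (col_mx (1 : 'M[S]_1) 0) (row_mx (1 : 'M[S]_1) 0) 0.

Lemma ambient_mxE (S : pzSemiRingType) (A : 'M[S]_n) b c :
  ambient_mx A b c = match kind_of b, kind_of c with
    | KindX i, KindX j => A i j
    | KindV, KindU | KindU, KindV => 1
    | _, _ => 0
    end.
Proof.
elim/ambient_index_ind: b => [|i|]; elim/ambient_index_ind: c => [|j|];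
rewrite !(kind_v, kind_x, kind_u) /ambient_mx /vI /xI /uI.
all: rewrite ?(block_mxEul, block_mxEur, block_mxEdl, block_mxEdr).
all: by rewrite ?(block_mxEul, block_mxEur, block_mxEdl, block_mxEdr,
  col_mxEu, col_mxEd, row_mxEl, row_mxEr) ?mxE.
Qed.

Lemma ambient_mx_tr (S : pzSemiRingType) (A : 'M[S]_n) :
  (ambient_mx A)^T = ambient_mx A^T.
Proof.
apply/matrixP => b c; rewrite mxE !ambient_mxE.
by case: (kind_of b); case: (kind_of c) => // *; rewrite mxE.
Qed.

Definition kindE := (kind_v, kind_x, kind_u).
Definition zeroE := (mulr0, mul0r, addr0, add0r, oppr0, subr0, mulr1, mul1r).

Lemma ambient_eqE b c : (b == c) = match kind_of b, kind_of c with
    | KindX i, KindX j => i == j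
    | KindV, KindV | KindU, KindU => true
    | _, _ => false
    end.
Proof.
case: (eqVneq b c) => [->|bc]; first by case: (kind_of c) => //= i; rewrite eqxx.
elim/ambient_index_ind: b bc => [|i|] bc; elim/ambient_index_ind: c bc => [|j|] bc;
  rewrite !kindE //; try by rewrite eqxx in bc.
by apply/esym/eqP => ij; rewrite ij eqxx in bc.
Qed.

Lemma ambient_mxM (S : pzSemiRingType) (A A' : 'M[S]_n) :
  A *m A' = 1%:M -> ambient_mx A *m ambient_mx A' = 1%:M.
Proof.
move=> AA; apply/matrixP => b c; rewrite mxE ambient_sum !ambient_mxE !kindE.
rewrite [RHS]mxE ambient_eqE.
under eq_bigr do rewrite !ambient_mxE ?kindE.
case: (kind_of b) => [|i|]; case: (kind_of c) => [|j|] /=.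
all: under eq_bigr do rewrite ?zeroE.
all: rewrite ?big1_eq ?zeroE //.
by have := congr1 (fun X : 'M[S]_n => X i j) AA; rewrite !mxE.
Qed.
End AmbientIndices.

(** Keeps some of the coordinate directions. The base derivations are the ambient ones along the
    x^i, so that base and ambient geometry share one ring. *)
Definition der_restrict (S : comPzRingType) m n (f : 'I_n -> 'I_m)
    (D : derivations S m) : derivations S n :=
  @Derivations S n (fun i => D (f i)) (fun i => derD D (f i))
    (fun i => derM D (f i)) (fun i j => derC D (f i) (f j)).

Section AmbientGeometry.
Variables (S : comPzRingType) (n : nat) (d : derivations S (1 + n + 1)).
Let D : derivations S n := der_restrict (@xI n) d.
Variables (h lam u v a Y : S) (P g gi C : 'M[S]_n) (G : 'I_n -> 'M[S]_n).
Hypotheses (h2 : h + h = 1).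
Hypotheses (lam0 : forall b, d b lam = 0).
Hypotheses (duu : d (uI n) u = 1) (dvu : d (vI n) u = 0).
Hypothesis (dxu : forall i, D i u = 0).
Hypotheses (duv : d (uI n) v = 0) (dvv : d (vI n) v = 1).
Hypothesis (dxv : forall i, D i v = 0).

(** The algebraic counterpart of being pulled back from the base. *)
Definition base_scalar x := d (vI n) x = 0 /\ d (uI n) x = 0.
Definition base_mx p q (A : 'M[S]_(p, q)) := forall i j, base_scalar (A i j).

Hypotheses (a_base : base_scalar a) (Y_base : base_scalar Y).
Hypotheses (g_base : base_mx g) (gi_base : base_mx gi) (P_base : base_mx P).
Hypothesis (G_base : forall i, base_mx (G i)).
Hypotheses (gT : g^T = g) (gig : gi *m g = 1%:M) (PT : P^T = P).
Hypotheses (tf : torsion_free G) (mc : metric_compat D G g).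

Let Q := P *m gi.
Let B : 'M[S]_n := 1%:M + u *: Q.
Hypothesis CB : C *m B = 1%:M.
(** The Codazzi property and the gradient of Y hold in both cases; the dichotomy itself survives
    only in [Q_curv], which serves to compute the Ricci tensor of [Gh] and its trace. *)
Hypothesis Q_codazzi : forall i j, codazzi D G Q i j = 0.
Hypothesis dY : dcol D Y = - (Q *m dcol D a).
Hypothesis YE : Y = Ypot D h G gi lam a.
Hypothesis PE : P = Pmx D G g lam a.
Hypothesis Q_curv : Q = 0 \/ forall i j, curv D G i j = 0.

Definition gu : 'M[S]_n := g + (2 * u) *: P + u ^+ 2 *: (P *m gi *m P).
Let K := Q *m C.
Let N := P *m B^T.
Let Gh i := (dmx D i B + B *m G i) *m C.

(* The Levi-Civita connection of 2 du dv + g_u: N is half of d_u g_u, and K is N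
   with its second index raised by g_u. *)
Definition ambient_conn (b : 'I_(1 + n + 1)) : 'M[S]_(1 + n + 1) :=
  \matrix_(c, e) match kind_of b, kind_of c, kind_of e with
    | KindX i, KindX j, KindV => - N i j
    | KindX i, KindX j, KindX l => Gh i j l
    | KindX i, KindU, KindX l => K i l
    | KindU, KindX j, KindX l => K j l
    | _, _, _ => 0
    end.

Let BC : B *m C = 1%:M := mulmx1C CB.

Let Qg : Q *m g = P.
Proof. by rewrite /Q -mulmxA gig mulmx1. Qed.

Let gQT : g *m Q^T = P.
Proof. by rewrite -{1}gT -trmx_mul Qg. Qed.

Lemma guE : gu = B *m g *m B^T.
Proof.
rewrite /gu /B mulmxDl mul1mx -scalemxAl Qg raddfD /= linearZ /= trmx1.
rewrite mulmxDr mulmx1 mulmxDl -!scalemxAl -!scalemxAr gQT.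
have -> : P *m Q^T = P *m gi *m P.
  by rewrite -{3}gQT mulmxA -[_ *m gi *m g]mulmxA gig mulmx1.
by apply/matrixP => i j; rewrite !mxE; ring.
Qed.

Let NT : N^T = N.
Proof.
rewrite /N trmx_mul trmxK PT /B mulmxDl mul1mx raddfD /= linearZ /= trmx1.
rewrite mulmxDr mulmx1 -scalemxAl -scalemxAr; congr (_ + _); congr (_ *: _).
by rewrite /Q trmx_mul PT (inv_sym gig gT) mulmxA.
Qed.

Let KguE : K *m gu = N.
Proof.
by rewrite guE /K !mulmxA -[Q *m C *m B]mulmxA CB mulmx1 Qg.
Qed.

Lemma gu_tr : gu^T = gu.
Proof. by rewrite guE !trmx_mul trmxK gT mulmxA. Qed.

Let der_base_mx p q (A : 'M[S]_(p, q)) : base_mx A ->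
  dmx d (vI n) A = 0 /\ dmx d (uI n) A = 0.
Proof. by move=> bA; split; apply/matrixP => i j; rewrite !mxE; case: (bA i j). Qed.

Let dvQ : dmx d (vI n) Q = 0.
Proof. by rewrite dmxM !(der_base_mx _).1 // mul0mx mulmx0 addr0. Qed.
Let duQ : dmx d (uI n) Q = 0.
Proof. by rewrite dmxM !(der_base_mx _).2 // mul0mx mulmx0 addr0. Qed.
Let dvB : dmx d (vI n) B = 0.
Proof. by rewrite dmxD dmx1 dmxZ dvu scale0r dvQ scaler0 !addr0. Qed.
Let duB : dmx d (uI n) B = Q.
Proof. by rewrite dmxD dmx1 dmxZ duu scale1r duQ scaler0 addr0 add0r. Qed.
Let dvC : dmx d (vI n) C = 0.
Proof. by rewrite (dmx_inv _ _ BC) dvB mulmx0 mul0mx oppr0. Qed.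
Let duC : dmx d (uI n) C = - (C *m Q *m C).
Proof. by rewrite (dmx_inv _ _ BC) duB. Qed.
Let dvK : dmx d (vI n) K = 0.
Proof. by rewrite dmxM dvQ dvC mul0mx mulmx0 addr0. Qed.
Let duK : dmx d (uI n) K = - (K *m K).
Proof. by rewrite dmxM duQ duC mul0mx add0r mulmxN /K !mulmxA. Qed.
Let dvN : dmx d (vI n) N = 0.
Proof. by rewrite dmxM dmx_tr dvB (der_base_mx _).1 // trmx0 mul0mx mulmx0 addr0. Qed.
Let dvgu : dmx d (vI n) gu = 0.
Proof.
by rewrite guE !dmxM dmx_tr dvB (der_base_mx _).1 // trmx0 !(mul0mx, mulmx0, addr0).
Qed.
Let dugu : dmx d (uI n) gu = N + N.
Proof.
rewrite guE !dmxM dmx_tr duB (der_base_mx _).2 // mulmx0 addr0 Qg.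
rewrite -mulmxA gQT; congr (_ + _).
by rewrite -[RHS]NT /N trmx_mul trmxK PT.
Qed.
Let dvGh i : dmx d (vI n) (Gh i) = 0.
Proof.
rewrite dmxM dvC mulmx0 addr0 dmxD dmxM dvB mul0mx (der_base_mx (G_base i)).1.
by rewrite mulmx0 !addr0 -[dmx D i B]/(dmx d (xI i) B) dmxC dvB dmx_zero mul0mx.
Qed.
Let duGh i : dmx d (uI n) (Gh i) = (dmx D i Q + Q *m G i) *m C - Gh i *m K.
Proof.
rewrite dmxM duC dmxD dmxM duB (der_base_mx (G_base i)).2 mulmx0 addr0.
rewrite -[dmx D i B]/(dmx d (xI i) B) dmxC duB -/D.
by rewrite mulmxN /Gh /K !mulmxA.
Qed.

(** As u is constant along the base, D_l B + B G_l splits into G_l, symmetric since G has no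
    torsion, and u times the covariant derivative of Q, symmetric by Codazzi. The common right
    factor C does not disturb this. *)
Let Gh_tf : torsion_free Gh.
Proof.
have e i j : row j (Gh i) = row i (Gh j).
  have := Q_codazzi j i; rewrite /codazzi => /eqP; rewrite subr_eq0 => /eqP cQ.
  have rowB k : row k B = row k 1%:M + u *: row k Q by rewrite /B !linearD !linearZ.
  have main k l : row k (dmx D l B + B *m G l) =
      u *: (dmx D l (row k Q) + row k Q *m G l) + row k (G l).
    rewrite raddfD /= -dmx_row row_mul !rowB dmxD dmxZ dxu scale0r add0r !dmx_row dmx1.
    rewrite mulmxDl -row_mul mul1mx -scalemxAl scalerDr raddf0 add0r.
    by rewrite -addrA; congr (_ + _); rewrite addrC.
  rewrite /Gh !row_mul !main cQ; congr ((_ + _) *m _).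
  by apply/matrixP => s t; rewrite !mxE tf.
by move=> i j k; have := congr1 (fun X : 'rV[S]_n => X 0 k) (e i j); rewrite !mxE.
Qed.

Let connE b c e : ambient_conn b c e = match kind_of b, kind_of c, kind_of e with
    | KindX i, KindX j, KindV => - N i j
    | KindX i, KindX j, KindX l => Gh i j l
    | KindX i, KindU, KindX l => K i l
    | KindU, KindX j, KindX l => K j l
    | _, _, _ => 0
    end.
Proof. by rewrite mxE. Qed.

Lemma ambient_conn_torsion_free : torsion_free ambient_conn.
Proof.
move=> b c e; rewrite !connE.
case: (kind_of b) => [|i|]; case: (kind_of c) => [|j|]; case: (kind_of e) => [|k|] //=.
  by rewrite (symE NT).
Qed.

(** Three facts cover the nontrivial components: the gauge transform for three base indices,
    [K *m gu = N] for the cancellations between x and u, and d_u gu = N + N. In addition, gu does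
    not depend on v. *)
Lemma ambient_conn_compat : metric_compat d ambient_conn (ambient_mx gu).
Proof.
move=> b; apply/matrixP => c e.
rewrite dmxE [RHS]mxE [X in _ = X + _]mxE [X in _ = _ + X]mxE.
under [X in _ = _ + X]eq_bigr do rewrite [_^T _ _]mxE.
rewrite !ambient_sum !ambient_mxE !connE !kindE.
under [X in _ = (_ + X + _) + _]eq_bigr do rewrite ambient_mxE connE kindE.
under [X in _ = _ + (_ + X + _)]eq_bigr do rewrite ambient_mxE connE kindE.
elim/ambient_index_ind: b => [|i|]; elim/ambient_index_ind: c => [|j|];
  elim/ambient_index_ind: e => [|k|]; rewrite !kindE /=.
all: under [X in _ = (_ + X + _) + _]eq_bigr do rewrite ?zeroE.
all: under [X in _ = _ + (_ + X + _)]eq_bigr do rewrite ?zeroE.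
all: rewrite ?big1_eq ?zeroE ?der0 ?der1 //.
- by rewrite -dmxE dvgu mxE.
- rewrite -[d (xI i)]/(D i) -dmxE guE (gauge_compat CB (mc i)) -guE -/(Gh i); move:
  gu (Gh i) => U V.
  by rewrite !mxE; congr (_ + _); apply: eq_bigr => l _; rewrite mxE.
- have := congr1 (fun X : 'M[S]_n => X i j) KguE; rewrite mxE => <-.
  rewrite addrC -sumrB big1 // => l _.
  by rewrite (symE gu_tr j) mulrC subrr.
- have := congr1 (fun X : 'M[S]_n => X i k) KguE; rewrite mxE => <-.
  by rewrite subrr.
- have e s t : N s t = \sum_i K s i * gu i t by rewrite -KguE mxE.
  rewrite -dmxE dugu mxE {1}e (symE NT) e; congr (_ + _).
  by apply: eq_bigr => l _; rewrite (symE gu_tr j) mulrC.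
Qed.

Let ric_summand b c e : S :=
  d e (ambient_conn b c e) - d b (ambient_conn e c e)
  + \sum_s ambient_conn b c s * ambient_conn e s e
  - \sum_s ambient_conn e c s * ambient_conn b s e.

Let ricE b c : ric d ambient_conn b c = \sum_e ric_summand b c e.
Proof.
rewrite /ric_summand; move: ambient_conn => A; rewrite mxE.
by apply: eq_bigr => e _; rewrite /curv !mxE.
Qed.

Let ric_summandE b c e : ric_summand b c e =
  match kind_of b, kind_of c, kind_of e with
  | KindX j, KindX k, KindX i => curv D Gh i j k i
  | KindX j, KindU, KindX i => d (xI i) (K j i) - d (xI j) (K i i)
      + \sum_l K j l * Gh i l i - \sum_l K i l * Gh j l i
  | KindU, KindX k, KindX i => d (xI i) (K k i) - d (uI n) (Gh i k i)
      + \sum_l K k l * Gh i l i - \sum_l Gh i k l * K l i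
  | KindU, KindU, KindX i => - d (uI n) (K i i) - \sum_l K i l * K l i
  | _, _, _ => 0
  end.
Proof.
have dvE p q (A : 'M[S]_(p, q)) s t : dmx d (vI n) A = 0 -> d (vI n) (A s t) = 0.
  by move=> A0; rewrite -dmxE A0 mxE.
rewrite /ric_summand !ambient_sum.
rewrite !connE !kindE.
under [X in _ + (_ + X + _) - _]eq_bigr do rewrite !connE kindE.
under [X in _ - (_ + X + _)]eq_bigr do rewrite !connE kindE.
elim/ambient_index_ind: b => [|j|]; elim/ambient_index_ind: c => [|k|];
  elim/ambient_index_ind: e => [|i|]; rewrite !kindE /=.
all: under [X in _ + (_ + X + _) - _]eq_bigr do rewrite ?zeroE.
all: under [X in _ - (_ + X + _)]eq_bigr do rewrite ?zeroE.
all: rewrite ?big1_eq ?der0 ?derN ?dvE ?zeroE //.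
by rewrite /curv; move: Gh => A; rewrite !mxE.
Qed.

(** K = Q C is Q read in the new frame, and [Gh] is G in that frame; hence the Codazzi property
    passes from Q to K. *)
Let dK l : dmx D l K + K *m Gh l = (dmx D l Q + Q *m G l) *m C.
Proof.
have cB : Q *m C *m (B *m G l *m C) = Q *m G l *m C.
  by rewrite !mulmxA -[Q *m C *m B]mulmxA CB mulmx1.
by rewrite /K dmxM (dmx_inv _ _ BC) /Gh mulmxDl mulmxDr cB; mx_linear.
Qed.

Let codazzi_K i j : codazzi D Gh K i j = 0.
Proof.
have e r l : dmx D l (row r K) + row r K *m Gh l =
    (dmx D l (row r Q) + row r Q *m G l) *m C.
  by rewrite !dmx_row -!row_mul -!linearD -row_mul dK.
by rewrite /codazzi !e -mulmxBl -/(codazzi D G Q i j) Q_codazzi mul0mx.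
Qed.

(** Outside the base block every summand of the trace already vanishes: for (x, u) by Codazzi for K,
    for (u, x) because d_u Gh is the covariant derivative of K, for (u, u) by the Riccati equation
    d_u K = - K^2. *)
Let ambient_ricE b c : ric d ambient_conn b c =
  match kind_of b, kind_of c with
  | KindX j, KindX k => ric D Gh j k
  | _, _ => 0
  end.
Proof.
rewrite ricE ambient_sum !ric_summandE !kindE.
under eq_bigr do rewrite ric_summandE !kindE.
case: (kind_of b) => [|j|]; case: (kind_of c) => [|k|] /=; rewrite ?big1_eq ?zeroE //.
- by rewrite mxE.
- rewrite big1 // => i _; have := congr1 (fun X : 'rV[S]_n => X 0 i) (codazzi_K j i).
  rewrite /codazzi; move: K Gh => k A; rewrite !mxE.
  have rs r l : \sum_s row r k 0 s * A l s i = \sum_s k r s * A l s i.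
    by apply: eq_bigr => s _; rewrite mxE.
  rewrite !rs.
  move=> e; rewrite -[RHS]e /D /=. ring.
- rewrite big1 // => i _.
  have : (dmx D i K + K *m Gh i - Gh i *m K - dmx d (uI n) (Gh i)) k i = 0.
    by rewrite dK duGh subrr mxE.
  move: K Gh => k' A; rewrite !mxE => e; rewrite -[RHS]e.
  by rewrite /D /=; ring.
- rewrite big1 // => i _.
  by rewrite -dmxE duK !mxE opprK subrr.
Qed.

Let psi : 'cV[S]_n := B *m dcol D a.
Let phit := a - u * Y - v + lam * u * v.

Let dphi b : d b phit = match kind_of b with
  | KindV => - 1 + lam * u
  | KindX i => psi i 0
  | KindU => - Y + lam * v
  end.
Proof.
have psiE i : psi i 0 = d (xI i) a - u * d (xI i) Y.
  have /(congr1 (fun X : 'cV[S]_n => X i 0)) := dY; rewrite [LHS]mxE [RHS]mxE => e.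
  rewrite -[d (xI i) Y]/(D i Y) e mulrN opprK /psi /B mulmxDl mul1mx -scalemxAl.
  by rewrite mxE [X in X + _]mxE [X in _ + X]mxE.
rewrite /phit !(derD, derN, derM) lam0.
elim/ambient_index_ind: b => [|i|]; rewrite kindE.
- by rewrite a_base.1 Y_base.1 dvu dvv; ring.
- by rewrite psiE -![d (xI i) _]/(D i _) dxu dxv; ring.
- by rewrite a_base.2 Y_base.2 duu duv; ring.
Qed.

(** The covector psi is B da, and [Gh] is gauged by the same B, so the derivatives of B cancel and B
    applied to the old Hessian remains. *)
Let psi_hess i j : D i (psi j 0) - \sum_k Gh i j k * psi k 0
  = (hess D G a *m B^T) i j.
Proof.
have -> : (hess D G a *m B^T) i j = (B *m (dmx D i (dcol D a) - G i *m dcol D a)) j 0.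
  rewrite [LHS]mxE [RHS]mxE; apply: eq_bigr => k _.
  by rewrite hessE [B^T _ _]mxE mulrC.
transitivity ((dmx D i psi - Gh i *m psi) j 0).
  by rewrite [RHS]mxE [X in _ = _ + X]mxE dmxE [X in _ = _ - X]mxE.
congr (fun_of_matrix _ j 0).
rewrite /Gh -mulmxA /psi [C *m _]mulmxA CB mul1mx dmxM; mx_linear.
Qed.

Let ric_Gh : ric D Gh = ric D G *m B^T.
Proof.
have e i j : curv D Gh i j = B *m curv D G i j *m C := gauge_curv D G i j CB.
case: Q_curv => [Q0|fl]; last first.
  apply/matrixP => j k; rewrite !mxE !big1 // => i _.
    by rewrite mxE big1 ?mul0r // => l _; rewrite fl mxE.
  by rewrite e fl mulmx0 mul0mx mxE.
have B1 : B = 1%:M by rewrite /B Q0 scaler0 addr0.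
have C1 : C = 1%:M by rewrite -CB B1 mulmx1.
rewrite B1 trmx1 mulmx1; apply/matrixP => j k; rewrite !mxE.
by apply: eq_bigr => i _; rewrite e B1 C1 mul1mx mulmx1.
Qed.

Let QlamE : ric D G + hess D G a = (Q + lam%:M) *m g.
Proof.
by rewrite mulmxDl Qg mul_scalar_mx PE /Pmx subrK.
Qed.

Let Kpsi : K *m psi = Q *m dcol D a.
Proof. by rewrite /K /psi mulmxA -[Q *m C *m B]mulmxA CB mulmx1. Qed.

Let dcol_base : base_mx (dcol D a).
Proof.
move=> i j; rewrite mxE; split; rewrite derC.
  by rewrite a_base.1 der0.
by rewrite a_base.2 der0.
Qed.

Lemma ambient_P : ric d ambient_conn + hess d ambient_conn phit
   - lam *: ambient_mx gu = 0.
Proof.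
apply/matrixP => b c; rewrite mxE [X in X + _]mxE ambient_ricE [X in _ + X + _]mxE.
rewrite ambient_sum !dphi !connE !kindE.
under eq_bigr do rewrite dphi connE kindE.
rewrite [X in _ + X]mxE [X in _ - X]mxE ambient_mxE [RHS]mxE.
have dlam e : d e (- 1 + lam * u) = lam * d e u.
  by rewrite derD derN der1 derM lam0; ring.
elim/ambient_index_ind: b => [|j|]; elim/ambient_index_ind: c => [|k|];
  rewrite !kindE /=.
all: under eq_bigr do rewrite ?zeroE.
all: rewrite ?big1_eq ?zeroE ?dlam ?dvu ?duu ?zeroE ?subrr //.
- by rewrite -dmxE dmxM dvB (der_base_mx dcol_base).1 mul0mx mulmx0 addr0 mxE.
- by rewrite derD derN derM lam0 Y_base.1 dvv; ring.
- by rewrite -[d (xI j) u]/(D j u) dxu mulr0.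
(* From (Q + lam) g B^T, using Q g B^T = N and g B^T = gu - u N. The terms in N are what the
   Christoffel symbol - N_ij with upper index v contributes against d_v phit = - 1 + lam u. *)
- have e0 : ric D Gh + hess D G a *m B^T = N + lam *: (gu - u *: N).
    rewrite ric_Gh -mulmxDl QlamE mulmxDl Qg mulmxDl -/N mul_scalar_mx -scalemxAl.
    congr (_ + _ *: _); rewrite guE /N scalemxAl -mulmxBl; congr (_ *m _).
    by rewrite /B mulmxDl mul1mx -scalemxAl Qg addrK.
  have e : ric D Gh j k + (D j (psi k 0) - \sum_i Gh j k i * psi i 0) =
      N j k + lam * (gu j k - u * N j k).
    rewrite psi_hess; transitivity ((ric D Gh + hess D G a *m B^T) j k).
      by rewrite [RHS]mxE.
    by rewrite e0; move: gu N => U V; rewrite !mxE.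
  rewrite -[d (xI j) _]/(D j _).
  have -> : ric D Gh j k = N j k + lam * (gu j k - u * N j k)
      - (D j (psi k 0) - \sum_i Gh j k i * psi i 0) by rewrite -e addrK.
  ring.
(* The mixed component (x, u) is - dY - K psi, which is zero exactly by the gradient formula for
   Y. *)
- have /(congr1 (fun X : 'cV[S]_n => X j 0)) := dY.
  rewrite -Kpsi [LHS]mxE [RHS]mxE [X in - X]mxE -[D j Y]/(d (xI j) Y) => e.
  rewrite derD derN derM lam0 e -[d (xI j) v]/(D j v) dxv; ring.
- rewrite -dmxE dmxM duB (der_base_mx dcol_base).2 mulmx0 addr0 -Kpsi mxE.
  by rewrite subrr.
- by rewrite derD derN derM lam0 Y_base.2 duv; ring.
Qed.

Definition gui : 'M[S]_n := C^T *m gi *m C.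

Lemma gui_gu : gui *m gu = 1%:M.
Proof.
rewrite /gui guE !mulmxA -[_ *m C *m B]mulmxA CB mulmx1 -[_ *m gi *m g]mulmxA.
by rewrite gig mulmx1 -trmx_mul BC trmx1.
Qed.

Let contractE m (A T : 'M[S]_m) : \sum_b \sum_c A b c * T b c = \tr (A *m T^T).
Proof.
by apply: eq_bigr => b _; rewrite mxE; apply: eq_bigr => c _; rewrite mxE.
Qed.

Let ambient_contract A (T : 'I_(1 + n + 1) -> 'I_(1 + n + 1) -> S) :
  \sum_b \sum_c ambient_mx A b c * T b c =
  T (vI n) (uI n) + \sum_i \sum_j A i j * T (xI i) (xI j) + T (uI n) (vI n).
Proof.
have row b : \sum_c ambient_mx A b c * T b c = match kind_of b with
    | KindV => T b (uI n)
    | KindX i => \sum_j A i j * T b (xI j)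
    | KindU => T b (vI n)
    end.
  rewrite ambient_sum !ambient_mxE !kindE.
  under eq_bigr do rewrite ambient_mxE kindE.
  by case: (kind_of b) => [|i|] /=; under eq_bigr do rewrite ?zeroE;
    rewrite ?big1_eq ?zeroE.
rewrite ambient_sum !row !kindE; congr (_ + _ + _).
by apply: eq_bigr => i _; rewrite row kindE.
Qed.

Let contract_ric : \tr (gui *m (ric D Gh)^T) = scal D G gi.
Proof.
rewrite ric_Gh trmx_mul trmxK /gui mulmxA -[_ *m C *m B]mulmxA CB mulmx1.
rewrite /scal contractE; case: Q_curv => [Q0|fl].
  have C1 : C = 1%:M by rewrite -CB /B Q0 scaler0 addr0 mulmx1.
  by rewrite C1 trmx1 mul1mx.
have -> : ric D G = 0.
  by apply/matrixP => i j; rewrite !mxE big1 // => s _; rewrite fl mxE.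
by rewrite trmx0 !mulmx0.
Qed.

Let contract_psi : (psi^T *m gui *m psi) 0 0 = gsq D gi a.
Proof.
rewrite gsqE /psi /gui trmx_mul; congr (fun_of_matrix _ 0 0).
have -> : (dcol D a)^T *m B^T *m (C^T *m gi *m C) = (dcol D a)^T *m gi *m C.
  by rewrite !mulmxA -[_ *m B^T *m C^T]mulmxA -trmx_mul CB trmx1 mulmx1.
by rewrite mulmxA -[_ *m C *m B]mulmxA CB mulmx1.
Qed.

(** The vanishing of the ambient P turns the Laplacian into (n + 2) lam - scal. As |d phit|^2 =
    |da|^2 + 2 (lam u - 1)(lam v - Y), the terms in u and v agree with those of 2 lam phit, and the
    remaining identity for 2 Y is the definition of Y. *)
Lemma ambient_F :
  \sum_b \sum_c ambient_mx gui b c * hess d ambient_conn phit b c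
  - gsq d (ambient_mx gui) phit + 2 * lam * phit - (1 + n + 1)%:R * lam = 0.
Proof.
have -> : gsq d (ambient_mx gui) phit =
    gsq D gi a + (- 1 + lam * u) * (- Y + lam * v) *+ 2.
  rewrite -contract_psi /gsq.
  under eq_bigr do under eq_bigr do rewrite -mulrA.
  rewrite (ambient_contract _ (fun b c => d b phit * d c phit)) !dphi !kindE.
  have -> : \sum_i \sum_j gui i j * (d (xI i) phit * d (xI j) phit) =
      (psi^T *m gui *m psi) 0 0.
    rewrite mxE exchange_big; apply: eq_bigr => j _ /=.
    rewrite mxE mulr_suml; apply: eq_bigr => i _.
    by rewrite !dphi !kindE [psi^T _ _]mxE; ring.
  ring.
have -> : hess d ambient_conn phit = lam *: ambient_mx gu - ric d ambient_conn.
  by apply/eqP; rewrite -subr_eq0 opprB addrCA addrA ambient_P.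
have -> : \sum_b \sum_c ambient_mx gui b c *
    (lam *: ambient_mx gu - ric d ambient_conn) b c =
    (1 + n + 1)%:R * lam - scal D G gi.
  rewrite contractE raddfB /= mulmxBr raddfB /= linearZ /= -scalemxAr ambient_mx_tr.
  rewrite gu_tr ambient_mxM ?gui_gu // mxtraceZ mxtrace1 mulrC; congr (_ - _).
  rewrite -contractE -contract_ric -contractE ambient_contract !ambient_ricE !kindE.
  rewrite add0r addr0; apply: eq_bigr => i _; apply: eq_bigr => j _.
  by rewrite ambient_ricE !kindE.
have e2 : Y *+ 2 = - (scal D G gi + gsq D gi a - 2 * lam * a).
  by rewrite YE /Ypot -[in RHS](half_mulr2n h2 (_ + _ - _)); ring.
rewrite /phit.
have -> : scal D G gi = - (Y *+ 2) - gsq D gi a + 2 * lam * a by rewrite e2; ring.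
ring.
Qed.

End AmbientGeometry.

(** * Symmetry, Codazzi property and gradient formula in the two cases *)

Section SolitonOrFlat.
Variables (S : comPzRingType) (n : nat) (D : derivations S n).
Variables (h lam a : S) (g gi : 'M[S]_n) (G : 'I_n -> 'M[S]_n).
Hypotheses (h2 : h + h = 1) (lam0 : forall i, D i lam = 0).
Hypotheses (gT : g^T = g) (gig : gi *m g = 1%:M).
Hypotheses (tf : torsion_free G) (mc : metric_compat D G g).
Let P := Pmx D G g lam a.
Hypothesis soliton_or_flat : P = 0 \/ forall i j, curv D G i j = 0.

Let ric_flat : (forall i j, curv D G i j = 0) -> ric D G = 0.
Proof.
by move=> fl; apply/matrixP => i j; rewrite !mxE big1 // => s _; rewrite fl mxE.
Qed.

(** No first Bianchi identity is called upon: either P is zero, or Ric is zero and the symmetric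
    Hessian and metric remain. *)
Lemma Pmx_sym : P^T = P.
Proof.
case: soliton_or_flat => [->|fl]; first by rewrite trmx0.
by rewrite /P /Pmx (ric_flat fl) add0r raddfB /= linearZ /= gT hess_sym.
Qed.

(** In the flat case P g^-1 is the raised Hessian minus lam; the Ricci identity disposes of the
    first and the absence of torsion of the second. *)
Lemma codazzi_P i j : codazzi D G (P *m gi) i j = 0.
Proof.
case: soliton_or_flat => [->|fl].
  by rewrite mul0mx -(subrr (0 : 'M[S]_n)) codazziB subrr.
rewrite /P /Pmx (ric_flat fl) add0r mulmxBl -scalemxAl (mulmx1C gig) scalemx1.
by rewrite codazziB (codazzi_hess gig mc) fl mulmx0 codazzi_scalar // subrr.
Qed.

Lemma dcol_Ypot : dcol D (Ypot D h G gi lam a) = - (P *m gi *m dcol D a).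
Proof.
apply: grad_Y => //; case: soliton_or_flat => [P0|fl] k.
  exact: (soliton_grad_scal h2 gT gig tf mc lam0 P0).
exact: flat_grad_scal.
Qed.
End SolitonOrFlat.

Lemma levi_civita_unique (S : comPzRingType) n (D : derivations S n) (h : S)
    (g gi : 'M[S]_n) (G G' : 'I_n -> 'M[S]_n) :
  h + h = 1 -> gi *m g = 1%:M -> g^T = g ->
  torsion_free G -> metric_compat D G g ->
  torsion_free G' -> metric_compat D G' g -> forall i, G i = G' i.
Proof.
move=> h2 gig gT tf mc tf' mc' i; apply/matrixP => j k.
by rewrite -(christ_unique h2 gig gT tf mc) (christ_unique h2 gig gT tf' mc').
Qed.

(** * The Hessian under a change of coordinates *)

Section ChangeOfCoordinates.
Variables (S T : comPzRingType) (n : nat).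
Variables (D : derivations S n) (E : derivations T n) (pb : T -> S).
Hypotheses (pbD : {morph pb : x y / x + y}) (pbM : {morph pb : x y / x * y}).
Variable J : 'M[S]_n.
Hypothesis chain : forall i f, D i (pb f) = \sum_k J i k * pb (E k f).
Hypothesis J_closed : forall i j k, D i (J j k) = D j (J i k).

Local Notation "A ^pb" := (map_mx pb A) (at level 2, format "A ^pb").

Let pb0 : pb 0 = 0.
Proof. by apply: (addrI (pb 0)); rewrite -pbD !addr0. Qed.

Let pb_sum I (r : seq I) (P : pred I) (F : I -> T) :
  pb (\sum_(k <- r | P k) F k) = \sum_(k <- r | P k) pb (F k).
Proof. exact: (big_morph pb pbD pb0). Qed.

Let pb_mxM p q r (A : 'M[T]_(p, q)) (B : 'M[T]_(q, r)) : (A *m B)^pb = A^pb *m B^pb.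
Proof.
by apply/matrixP => i j; rewrite !mxE pb_sum; apply: eq_bigr => k _; rewrite pbM !mxE.
Qed.

Let pb_mxD p q (A B : 'M[T]_(p, q)) : (A + B)^pb = A^pb + B^pb.
Proof. by apply/matrixP => i j; rewrite !mxE pbD. Qed.

Let pb_mxN p q (A : 'M[T]_(p, q)) : (- A)^pb = - A^pb.
Proof.
by apply: (addrI A^pb); rewrite -pb_mxD !subrr; apply/matrixP => i j; rewrite !mxE.
Qed.

Lemma dmx_pb i p q (A : 'M[T]_(p, q)) :
  dmx D i A^pb = \sum_k J i k *: (dmx E k A)^pb.
Proof.
apply/matrixP => s t; rewrite !mxE chain summxE.
by apply: eq_bigr => k _; rewrite !mxE.
Qed.

Lemma dcol_pb f : dcol D (pb f) = J *m (dcol E f)^pb.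
Proof.
apply/matrixP => s t; rewrite !mxE chain; by apply: eq_bigr => k _; rewrite !mxE.
Qed.

Variables (h : S) (g gi : 'M[S]_n) (G : 'I_n -> 'M[S]_n).
Variables (g' : 'M[T]_n) (G' : 'I_n -> 'M[T]_n).
Hypotheses (h2 : h + h = 1) (gT : g^T = g) (gig : gi *m g = 1%:M).
Hypotheses (tf : torsion_free G) (mc : metric_compat D G g).
Hypotheses (tf' : torsion_free G') (mc' : metric_compat E G' g').
Hypothesis gE : g = J *m g'^pb *m J^T.

Let C := g'^pb *m J^T *m gi.
Let JC : J *m C = 1%:M.
Proof. by rewrite /C !mulmxA -gE (mulmx1C gig). Qed.

(* By uniqueness, the Levi-Civita connection of g is the gauge transform by J of
   the pulled-back connection of g'. *)
Let Gp i := \sum_k J i k *: (G' k)^pb.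
Let GJ i := (dmx D i J + J *m Gp i) *m C.

Let G_GJ i : G i = GJ i.
Proof.
apply: (levi_civita_unique h2 gig gT tf mc) => {i} [i j k|i]; last first.
  rewrite gE; apply: gauge_compat; first exact: mulmx1C.
  rewrite dmx_pb /Gp mulmx_suml linear_sum /= mulmx_sumr -big_split /=.
  apply: eq_bigr => k _; rewrite mc' pb_mxD !pb_mxM linearZ /= -scalemxAl -scalemxAr.
  by rewrite scalerDr map_trmx.
(* Torsion: the first term is symmetric because J is a Jacobian, the second because [G'] is torsion
   free. *)
have e : row j (dmx D i J + J *m Gp i) = row i (dmx D j J + J *m Gp j).
  apply/matrixP => s t; rewrite !mxE J_closed; congr (_ + _).
  under eq_bigr do rewrite summxE mulr_sumr.
  under [RHS]eq_bigr do rewrite summxE mulr_sumr.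
  rewrite exchange_big; apply: eq_bigr => b _; apply: eq_bigr => c _ /=.
  rewrite !mxE tf'; ring.
have := congr1 (fun X => (X *m C) 0 k) e.
by rewrite -!row_mul !mxE.
Qed.

(** The inhomogeneous term D_i J occurs once in the derivative of J df and once in the
    gauge-transformed connection, and cancels. *)
Lemma hess_change f :
  hess D G (pb f) = J *m (hess E G' f)^pb *m J^T.
Proof.
apply/matrixP => i j; rewrite hessE dcol_pb dmxM dmx_pb G_GJ.
have -> : GJ i *m (J *m (dcol E f)^pb) = (dmx D i J + J *m Gp i) *m (dcol E f)^pb.
  by rewrite /GJ -mulmxA [C *m _]mulmxA (mulmx1C JC) mul1mx.
have -> : dmx D i J *m (dcol E f)^pb
    + J *m (\sum_k J i k *: (dmx E k (dcol E f))^pb)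
    - (dmx D i J + J *m Gp i) *m (dcol E f)^pb
  = J *m (\sum_k J i k *: (dmx E k (dcol E f) - G' k *m dcol E f)^pb).
  have -> : \sum_k J i k *: (dmx E k (dcol E f) - G' k *m dcol E f)^pb =
     \sum_k J i k *: (dmx E k (dcol E f))^pb - Gp i *m (dcol E f)^pb.
    rewrite /Gp mulmx_suml -sumrB; apply: eq_bigr => k _.
    by rewrite pb_mxD pb_mxN pb_mxM scalerDr scalerN scalemxAl.
  move: (\sum_k _) => X; mx_linear.
rewrite [LHS]mxE [RHS]mxE; apply: eq_bigr => k _.
rewrite [J^T _ _]mxE mulrC; congr (_ * _).
rewrite summxE mxE; apply: eq_bigr => l _.
by rewrite mxE [in LHS]mxE [X in _ = _ * X]mxE hessE.
Qed.

End ChangeOfCoordinates.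

Local Open Scope classical_set_scope.
Local Open Scope ring_scope.

(** * Smooth functions of several variables *)

Section SmoothFunctions.
Variables (R : realType) (m : nat).
Implicit Types (U V : set 'rV[R]_m) (f g : 'rV[R]_m -> R) (i j : 'I_m).

Lemma open_near_eq U f g x : open U -> U x -> (forall y, U y -> f y = g y) ->
  {near x, f =1 g}.
Proof.
by move=> oU Ux fg; move: (open_nbhs_nbhs (conj oU Ux)); apply: filterS => y /fg.
Qed.

Lemma near_eq_continuous f g (x : 'rV[R]_m) : {near x, f =1 g} ->
  {for x, continuous f} -> {for x, continuous g}.
Proof.
move=> fg; rewrite /prop_for /continuous_at (nbhs_singleton fg) => cf.
exact: cvg_trans (near_eq_cvg fg) cf.
Qed.

Lemma partial_eq U f g i x : open U -> U x -> (forall y, U y -> f y = g y) ->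
  partial i f x = partial i g x.
Proof. by move=> oU Ux fg; apply: near_eq_derive; exact: open_near_eq oU Ux fg. Qed.

Lemma Ck_eq k U f g : open U -> (forall y, U y -> f y = g y) ->
  Ck_on k U f -> Ck_on k U g.
Proof.
move=> oU; elim: k f g => [|k IH] f g fg [cf Hf].
  by split=> // x Ux; apply: near_eq_continuous (cf x Ux); exact: open_near_eq oU Ux fg.
split=> [x Ux|].
  by apply: near_eq_continuous (cf x Ux); exact: open_near_eq oU Ux fg.
case: Hf => df Hf; split=> [i x Ux|i].
  by apply: near_eq_derivable (df i x Ux); exact: open_near_eq oU Ux fg.
by apply: IH (Hf i) => y Uy; exact: partial_eq oU Uy fg.
Qed.

Lemma Ck_sub k U V f : V `<=` U -> Ck_on k U f -> Ck_on k V f.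
Proof.
move=> VU; elim: k f => [|k IH] f [cf Hf]; split=> //; try by move=> x /VU /cf.
by case: Hf => df Hf; split=> [i x /VU Ux|i]; [exact: df|exact: IH (Hf i)].
Qed.

Lemma CkW k U f : Ck_on k.+1 U f -> Ck_on k U f.
Proof.
elim: k f => [|k IH] f [cf [df Hf]]; split=> //.
by split=> // i; exact: IH.
Qed.

Lemma Ck_leq k l U f : (k <= l)%N -> Ck_on l U f -> Ck_on k U f.
Proof. by move=> /subnK <-; elim: (l - k)%N => // r IH /CkW. Qed.

Lemma Ck_cst k U (a : R) : Ck_on k U (cst a).
Proof.
elim: k a => [|k IH] a; first by split=> // x _; apply: cst_continuous.
split=> [x _|]; first exact: cst_continuous.
split=> [i x _|i]; first exact: derivable_cst.
have -> : partial i (cst a : 'rV_m -> R) = cst 0.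
  by apply/funext => x; rewrite /partial derive_cst.
exact: IH.
Qed.

Lemma CkD k U f g : open U -> Ck_on k U f -> Ck_on k U g -> Ck_on k U (f + g).
Proof.
move=> oU; elim: k f g => [|k IH] f g [cf Hf] [cg Hg].
  by split=> // x Ux; apply: continuousD; [exact: cf | exact: cg].
split=> [x Ux|]; first by apply: continuousD; [exact: cf | exact: cg].
case: Hf Hg => df Hf [dg Hg]; split=> [i x Ux|i].
  by apply: derivableD; [exact: df | exact: dg].
apply: (Ck_eq (f := partial i f + partial i g)) => //; last exact: (IH _ _ (Hf i) (Hg
  i)).
by move=> y Uy; rewrite /partial deriveD //; [exact: df | exact: dg].
Qed.

Lemma CkM k U f g : open U -> Ck_on k U f -> Ck_on k U g -> Ck_on k U (f * g).
Proof.
move=> oU; elim: k f g => [|k IH] f g Cf Cg; move: (Cf) (Cg) => [cf Hf] [cg Hg].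
  by split=> // x Ux; apply: continuousM; [exact: cf | exact: cg].
split=> [x Ux|]; first by apply: continuousM; [exact: cf | exact: cg].
case: Hf Hg => df Hf [dg Hg]; split=> [i x Ux|i].
  by apply: derivableM; [exact: df | exact: dg].
apply: (Ck_eq (f := f * partial i g + g * partial i f)) => //.
  by move=> y Uy; rewrite /partial deriveM //; [exact: df | exact: dg].
by apply: CkD => //; [exact: (IH _ _ (CkW Cf) (Hg i))|exact: (IH _ _ (CkW Cg) (Hf i))].
Qed.

Lemma CkN k U f : open U -> Ck_on k U f -> Ck_on k U (- f).
Proof.
move=> oU Cf; apply: (Ck_eq (f := cst (- 1) * f)) => //.
  by move=> y _; rewrite -[LHS]/(- 1 * f y) mulN1r.
by apply: CkM => //; exact: Ck_cst.
Qed.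

Lemma Ck_sum k U I (r : seq I) (F : I -> 'rV[R]_m -> R) : open U ->
  (forall l, Ck_on k U (F l)) -> Ck_on k U (\sum_(l <- r) F l).
Proof.
move=> oU CF; elim: r => [|l r IH]; last by rewrite big_cons; exact: CkD.
by rewrite big_nil; exact: (Ck_cst k U 0).
Qed.

Lemma CkV k U f : open U -> (forall x, U x -> f x != 0) ->
  Ck_on k U f -> Ck_on k U (fun x => (f x)^-1).
Proof.
move=> oU f0; elim: k f f0 => [|k IH] f f0 Cf; move: (Cf) => [cf Hf].
  by split=> // x Ux; apply: continuousV; [exact: f0 | exact: cf].
split=> [x Ux|]; first by apply: continuousV; [exact: f0 | exact: cf].
case: Hf => df Hf; split=> [i x Ux|i].
  by apply: derivableV; [exact: f0 | exact: df].
pose fi x := (f x)^-1.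
apply: (Ck_eq (f := - (fi * fi * partial i f))) => //.
  move=> y Uy; rewrite /partial deriveV ?f0 //; last exact: df.
  by rewrite /fi -exprVn scaleNr.
apply: CkN => //; have Cfi := IH _ f0 (CkW Cf).
by apply: CkM (Hf i) => //; exact: CkM.
Qed.

Lemma smooth_eq U f g : open U -> (forall y, U y -> f y = g y) ->
  smooth_on U f -> smooth_on U g.
Proof. by move=> oU fg sf k; exact: Ck_eq oU fg (sf k). Qed.

Lemma smooth_partial U f i : smooth_on U f -> smooth_on U (partial i f).
Proof. by move=> sf k; have [_ [_]] := sf k.+1; exact. Qed.

Lemma smooth_derivable U f i x : smooth_on U f -> U x ->
  derivable f x (delta_mx ord0 i).
Proof. by move=> sf Ux; have [_ [df _]] := sf 1%N; exact: df. Qed.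

Lemma smooth_continuous U f x : smooth_on U f -> U x -> {for x, continuous f}.
Proof. by move=> sf; have [cf _] := sf 0%N; exact: cf. Qed.

Lemma is_derive_coord i j (x : 'rV[R]_m) :
  is_derive x (delta_mx 0 j) (fun x : 'rV[R]_m => x 0 i) (i == j)%:R.
Proof.
apply: DeriveDef.
  by have /derivable_mxP := @derivable_id R 'rV[R]_m x (delta_mx 0 j).
have := derive_mx (@derivable_id R 'rV[R]_m x (delta_mx 0 j)).
by rewrite derive_id => /matrixP/(_ 0 i); rewrite [RHS]mxE mxE eqxx /= => <-.
Qed.

Lemma partial_coord i j : partial j (fun x : 'rV[R]_m => x 0 i) = cst (i == j)%:R.
Proof.
by apply/funext => x; rewrite /partial; have [_ ->] := is_derive_coord i j x.
Qed.

Lemma smooth_coord U i : smooth_on U (fun x : 'rV[R]_m => x 0 i).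
Proof.
case=> [|k]; first by split=> // x _; exact: coord_continuous.
split=> [x _|]; first exact: coord_continuous.
split=> [j x _|j]; first by have [] := is_derive_coord i j x.
by rewrite partial_coord; exact: Ck_cst.
Qed.

End SmoothFunctions.

(** The bound for every e makes the remainder o(h); uniqueness of the differential then identifies
    it with [df]. *)
Lemma differentiable_estimate (R : realType) (V W : normedModType R)
    (f : V -> W) (df : {linear V -> W}) (x : V) : continuous df ->
  (forall e : R, 0 < e -> \forall h \near 0, `|f (h + x) - f x - df h| <= e * `|h|) ->
  differentiable f x /\ 'd f x = df :> (V -> W).
Proof.
move=> cdf est; have o : f \o shift x = cst (f x) + df +o_ 0 id.
  apply/eqaddoP => e e0; have := est e e0; apply: filterS => h.
  by rewrite -[X in _ -> is_true (`|X| <= _)]/(f (h + x) - (f x + df h)) opprD addrA.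
have e := diff_unique cdf o; split => //.
by apply/diff_locallyP; rewrite e.
Qed.

(** * Mean value estimates, symmetry of second partials, differentiability of C^1 functions *)

Section MeanValue.
Variables (R : realType) (m : nat).
Implicit Types (U V : set 'rV[R]_m) (f g : 'rV[R]_m -> R) (i j : 'I_m).
Implicit Types (p v : 'rV[R]_m).

Lemma is_derive_line f p v (s : R) : derivable f (p + s *: v) v ->
  is_derive s (1 : R) (fun t => f (p + t *: v)) ('D_v f (p + s *: v)).
Proof.
move=> df.
have e : (fun h : R => h^-1 *: (((fun t => f (p + t *: v)) \o shift s) (h *: 1) -
      f (p + s *: v))) =
    (fun h : R => h^-1 *: ((f \o shift (p + s *: v)) (h *: v) - f (p + s *: v))).
  apply/funext => h /=; congr (_ *: (f _ - _)).
  by rewrite scaler1 scalerDl addrCA.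
by apply: DeriveDef; rewrite /derivable /derive e.
Qed.

Lemma is_derive_translate f (y w v : 'rV[R]_m) : derivable f (y + w) v ->
  is_derive y v (fun z => f (z + w)) ('D_v f (y + w)).
Proof.
move=> df.
have e : (fun h : R => h^-1 *: (((fun z => f (z + w)) \o shift y) (h *: v) - f (y +
  w))) =
    (fun h : R => h^-1 *: ((f \o shift (y + w)) (h *: v) - f (y + w))).
  by apply/funext => h /=; rewrite addrA.
by apply: DeriveDef; rewrite /derivable /derive e.
Qed.

Lemma line_MVT f p v (a b : R) : a < b ->
  (forall s, a <= s <= b -> derivable f (p + s *: v) v) ->
  exists2 c, a < c < b &
    f (p + b *: v) - f (p + a *: v) = 'D_v f (p + c *: v) * (b - a).
Proof.
move=> ab df; have [] := @MVT R (fun t => f (p + t *: v))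
  (fun t => 'D_v f (p + t *: v)) a b ab.
- move=> x /[!in_itv] /= /andP[ax xb]; apply: is_derive_line; apply: df.
  by rewrite !ltW.
- apply: derivable_within_continuous => x /[!in_itv] /= axb.
  by have [] := is_derive_line (df x axb).
- by move=> c /[!in_itv] /= acb e; exists c.
Qed.

Lemma line_increment f p v (t e L : R) :
  (forall s, `|s| <= `|t| -> derivable f (p + s *: v) v) ->
  (forall s, `|s| <= `|t| -> `|'D_v f (p + s *: v) - L| <= e) ->
  `|f (p + t *: v) - f p - t * L| <= `|t| * e.
Proof.
move=> df De; have fp : f p = f (p + 0 *: v) by rewrite scale0r addr0.
have [t0|t0|<-] := ltgtP 0 t; last first.
- by rewrite scale0r addr0 subrr mul0r subrr normr0 mul0r.
- have [s|c /andP[tc c0]] := @line_MVT f p v t 0 t0.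
    by move=> /andP[ts s0]; apply: df; rewrite !ler0_norm ?lerN2 // ltW.
  rewrite -fp sub0r => E.
  have -> : f (p + t *: v) - f p - t * L = t * ('D_v f (p + c *: v) - L).
    by rewrite -[_ - f p]opprB E; ring.
  rewrite normrM ler_wpM2l //; apply: De.
  by rewrite !ler0_norm ?lerN2 // ltW.
- have [s|c /andP[tc c0]] := @line_MVT f p v 0 t t0.
    by move=> /andP[s0 ts]; apply: df; rewrite !ger0_norm // ltW.
  rewrite -fp subr0 => ->.
  have -> : 'D_v f (p + c *: v) * t - t * L = t * ('D_v f (p + c *: v) - L) by ring.
  rewrite normrM ler_wpM2l //; apply: De.
  by rewrite !ger0_norm // ltW.
Qed.

Lemma delta_norm i : `|delta_mx 0 i : 'rV[R]_m| <= 1.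
Proof.
rewrite /Num.Def.normr/= mx_normrE; apply: bigmax_le => // -[a b] _.
by rewrite mxE; case: (_ && _); rewrite ?normr1 ?normr0.
Qed.

(** The mean value theorem applied first along i to the increment of f along j, then along j to the
    i-th partial. The point found is displaced by at most s in each of two directions, hence the
    radius 2 s. *)
Lemma second_difference U f x i j (s : R) : 0 < s ->
  (forall y, `|y - x| <= 2 * s -> U y) ->
  (forall k y, U y -> derivable f y (delta_mx 0 k)) ->
  (forall k l y, U y -> derivable (partial k f) y (delta_mx 0 l)) ->
  exists2 y, `|y - x| <= 2 * s &
    f (x + s *: delta_mx 0 i + s *: delta_mx 0 j) - f (x + s *: delta_mx 0 i)
      - (f (x + s *: delta_mx 0 j) - f x) = partial j (partial i f) y * s * s.
Proof.
move=> s0 xU df ddf.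
pose ei : 'rV[R]_m := delta_mx 0 i; pose ej : 'rV[R]_m := delta_mx 0 j.
have near_x a b : 0 <= a <= s -> 0 <= b <= s -> `|x + a *: ei + b *: ej - x| <= 2 * s.
  move=> /andP[a0 as_] /andP[b0 bs].
  rewrite -(addrA x) addrAC subrr add0r (le_trans (ler_normD _ _)) // !normrZ.
  rewrite !ger0_norm //.
  have := ler_wpM2l a0 (delta_norm i); have := ler_wpM2l b0 (delta_norm j).
  by rewrite !mulr1 => h1 h2; lra.
pose F := fun y => f (y + s *: ej) - f y.
have derF y : U y -> U (y + s *: ej) ->
    is_derive y ei F (partial i f (y + s *: ej) - partial i f y).
  move=> Uy Uys; have dfs := is_derive_translate (df i _ Uys).
  have dfy : is_derive y ei f ('D_ei f y) by apply: DeriveDef => //; exact: df.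
  exact: is_deriveB.
have zs : 0 <= (0:R) <= s by rewrite lexx ltW.
have ss : 0 <= s <= s by rewrite lexx ltW.
have near_x0 a : 0 <= a <= s -> `|x + a *: ei - x| <= 2 * s.
  by move=> /near_x/(_ zs); rewrite scale0r addr0.
have [r rs|c /andP[c0 cs]] := @line_MVT F x ei 0 s s0.
  have [] // := derF (x + r *: ei) _ _; first by apply: xU; exact: near_x0.
  by apply: xU; exact: near_x.
have c0s : 0 <= c <= s by rewrite !ltW.
rewrite scale0r addr0 subr0.
have [_ ->] := derF (x + c *: ei) (xU _ (near_x0 _ c0s)) (xU _ (near_x _ _ c0s ss)).
have [r rs|d /andP[d0 ds]] := @line_MVT (partial i f) (x + c *: ei) ej 0 s s0.
  by apply: ddf; apply: xU; exact: near_x.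
rewrite scale0r addr0 subr0 => -> E.
exists (x + c *: ei + d *: ej); first by apply: near_x => //; rewrite !ltW.
exact: E.
Qed.

(** The second difference is symmetric in i and j, so the two mixed partials take a common value at
    two points close to x; continuity transfers this to x. *)
Lemma partialC U f x i j : open U -> U x -> smooth_on U f ->
  partial i (partial j f) x = partial j (partial i f) x.
Proof.
move=> oU Ux sf; apply/eqP; rewrite -subr_eq0 -normr_eq0; apply/eqP.
set A := partial i (partial j f); set B := partial j (partial i f).
apply/eqP; rewrite eq_le normr_ge0 andbT; apply/ler_addgt0Pl => e e0; rewrite addr0.
have e2 : 0 < e / 2 by rewrite divr_gt0.
have cont k l : {for x, continuous (partial k (partial l f))}.
  by apply: (@smooth_continuous _ _ U) => //; do 2 apply: smooth_partial.
have nbA : \forall y \near x, `|A x - A y| < e / 2 by have /cvgrPdist_lt/(_ _ e2) :=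
  cont i j.
have nbB : \forall y \near x, `|B x - B y| < e / 2 by have /cvgrPdist_lt/(_ _ e2) :=
  cont j i.
have nbU : \forall y \near x, U y by exact: open_nbhs_nbhs.
have [r r0 rP] := (nbhs_normP _ _).1 (filterI nbU (filterI nbA nbB)).
(* With step r / 4 the radius 2 (r / 4) stays strictly below r. *)
have r4 : 0 < r / 4 by rewrite divr_gt0.
have xr y : `|y - x| <= 2 * (r / 4) -> ball_ Num.norm x r y.
  by move=> yx; rewrite /ball_ /= distrC (le_lt_trans yx) //; move: r0 => /= ?; lra.
have df k y : U y -> derivable f y (delta_mx 0 k) by exact: smooth_derivable.
have ddf k l y : U y -> derivable (partial k f) y (delta_mx 0 l).
  by apply: smooth_derivable; exact: smooth_partial.
have UP y : `|y - x| <= 2 * (r / 4) -> U y by move=> /xr/rP [].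
have [y1 /xr/rP [_ [_ B1]] E1] := @second_difference U f x i j (r / 4) r4 UP df ddf.
have [y2 /xr/rP [_ [A2 _]] E2] := @second_difference U f x j i (r / 4) r4 UP df ddf.
have E : B y1 = A y2.
  have r40 : r / 4 != 0 by rewrite gt_eqF.
  have swap (a b c d : R) : a - b - (c - d) = a - c - (b - d) by ring.
  apply: (mulIf r40); apply: (mulIf r40); apply: (etrans (esym E1)).
  by apply: etrans E2; rewrite (addrAC x) swap.
have -> : A x - B x = (A x - A y2) - (B x - B y1) by rewrite E opprB addrA subrK.
apply: (le_trans (ler_normB _ _)); rewrite (splitr e).
by apply: lerD; apply: ltW; [exact: A2|exact: B1].
Qed.

Definition grad_form (c v : 'rV[R]_m) : R := \sum_i v 0 i * c 0 i.

Lemma grad_form_linear c : linear (grad_form c).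
Proof.
move=> a u v; rewrite /grad_form scaler_sumr -big_split; apply: eq_bigr => i _ /=.
by rewrite !mxE mulrDl -mulrA.
Qed.

HB.instance Definition _ c :=
  GRing.isLinear.Build R 'rV[R]_m R *:%R (grad_form c) (grad_form_linear c).

Lemma grad_form_continuous c : continuous (grad_form c).
Proof.
have e : grad_form c = \sum_i ((fun v : 'rV[R]_m => v 0 i) * cst (c 0 i)).
  by apply/funext => v; rewrite fct_sumE.
have [] : Ck_on 0 setT (grad_form c); last by move=> cf _ x; exact: cf.
rewrite e; apply: Ck_sum => [|i]; first exact: openT.
by apply: CkM; [exact: openT|exact: smooth_coord|exact: Ck_cst].
Qed.

(** The path from x to x + h runs along one coordinate at a time; on each leg the increment is
    controlled by the continuity of a single partial derivative. *)
Lemma C1_estimate U f x (e : R) : open U -> U x -> Ck_on 1 U f -> 0 < e ->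
  \forall h \near (0 : 'rV[R]_m), `|f (h + x) - f x - grad_form (\row_i partial i f
    x) h| <= e * `|h|.
Proof.
move=> oU Ux [_ [df cdf]] e0.
set c := \row_i _.
(* There are m legs; the successor keeps the denominator nonzero when m = 0. *)
pose e' := e / m.+1%:R.
have e'0 : 0 < e' by rewrite divr_gt0.
have nbd : \forall y \near x, forall i, `|partial i f x - partial i f y| < e'.
  apply: (@filter_forall _ _ (fun i y => `|partial i f x - partial i f y| < e') (nbhs
    x) (nbhs_filter x)) => i.
  have [cp _] := cdf i.
  by have /cvgrPdist_lt/(_ _ e'0) := cp x Ux.
have nbU : \forall y \near x, U y by exact: open_nbhs_nbhs.
have [r r0 rP] := (nbhs_normP _ _).1 (filterI nbU nbd).
have nbh : \forall h \near (0 : 'rV[R]_m), `|h| < r by exact: nbhs0_lt.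
move: nbh; apply: filterS => h hr.
(* The corners of the path; all of them, and the legs between them, have norm at most that of h in
   the sup norm. *)
pose trunc k : 'rV[R]_m := \row_i (if (i < k)%N then h 0 i else 0).
have trunc0 : trunc 0%N = 0 by apply/rowP => i; rewrite !mxE.
have truncm : trunc m = h by apply/rowP => i; rewrite !mxE ltn_ord.
have truncS (k : 'I_m) : trunc k.+1 = trunc k + h 0 k *: delta_mx 0 k.
  apply/rowP => i; rewrite !mxE eqxx /= ltnS leq_eqVlt -val_eqE.
  by case: eqP => [ik|ik] /=; rewrite ?ik ?ltnn ?mulr1 ?add0r ?mulr0 ?addr0 //
    (val_inj ik).
have coord i : `|h 0 i| <= `|h|.
  by rewrite {2}/Num.Def.normr/= mx_normrE; exact: (le_bigmax _ (fun k => `|h k.1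
    k.2|) (0, i)).
have trunc_near (k : 'I_m) s : `|s| <= `|h 0 k| ->
    ball_ Num.norm x r (x + trunc k + s *: delta_mx 0 k).
  move=> sh; rewrite /ball_ /= distrC -(addrA x) (addrC x) addrK.
  apply: le_lt_trans hr; rewrite {1}/Num.Def.normr/= mx_normrE.
  apply: bigmax_le => // -[a i] _ /=; rewrite ord1 !mxE eqxx /=.
  have [->|ik] := eqVneq i k; first by rewrite ltnn add0r mulr1 (le_trans sh).
  by rewrite mulr0 addr0; case: ifP; rewrite ?normr0.
have -> : f (h + x) - f x - grad_form c h =
    \sum_(k < m) (f (x + trunc k.+1) - f (x + trunc k) - h 0 k * c 0 k).
  rewrite sumrB -(big_mkord xpredT (fun k => f (x + trunc k.+1) - f (x + trunc k))).
  rewrite telescope_sumr // truncm trunc0 addr0.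
  by rewrite (addrC h).
apply: (@le_trans _ _ (\sum_(k < m) `|h| * e')).
  apply: (le_trans (ler_norm_sum _ _ _)); apply: ler_sum => k _.
  rewrite truncS addrA; apply: le_trans (_ : `|h 0 k| * e' <= _).
    apply: line_increment => s sh; first by apply: df; have [] := rP _ (trunc_near k
      s sh).
    have [_ /(_ k)] := rP _ (trunc_near k s sh).
    by rewrite mxE distrC => /ltW.
  by rewrite ler_wpM2r // ltW.
rewrite sumr_const card_ord -mulr_natr -mulrA mulrC ler_wpM2r //.
rewrite /e' -mulrA; apply: ler_piMr; first exact: ltW.
by rewrite mulrC ler_pdivrMr // mul1r ler_nat.
Qed.

Lemma C1_differentiable U f x : open U -> U x -> Ck_on 1 U f -> differentiable f x.
Proof.
move=> oU Ux Cf; have cL := @grad_form_continuous (\row_i partial i f x).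
by have [] := differentiable_estimate cL (fun e => C1_estimate oU Ux Cf).
Qed.

Lemma C1_diff U f x v : open U -> U x -> Ck_on 1 U f ->
  'd f x v = \sum_i v 0 i * partial i f x.
Proof.
move=> oU Ux Cf; have cL := @grad_form_continuous (\row_i partial i f x).
have [_ ->] := differentiable_estimate cL (fun e => C1_estimate oU Ux Cf).
by apply: eq_bigr => i _; rewrite mxE.
Qed.

End MeanValue.

(** * Chain rule and composition of smooth maps *)

Section Composition.
Variables (R : realType) (m n : nat) (tau : 'rV[R]_m -> 'rV[R]_n).
Variables (U : set 'rV[R]_m) (V : set 'rV[R]_n).
Hypotheses (oU : open U) (oV : open V) (tauUV : forall x, U x -> V (tau x)).
Hypothesis tau_smooth : forall k, smooth_on U (fun x => tau x 0 k).
Implicit Types (f : 'rV[R]_n -> R) (x v : 'rV[R]_m).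

Lemma smooth_map_differentiable x : U x -> differentiable tau x.
Proof.
move=> Ux; have -> : tau = \sum_k (fun y => tau y 0 k *: (delta_mx 0 k : 'rV[R]_n)).
  by apply/funext => y; rewrite fct_sumE [LHS]row_sum_delta.
apply: differentiable_sum => k; apply: differentiableZl.
exact: C1_differentiable oU Ux (tau_smooth k 1%N).
Qed.

Lemma smooth_map_diffE x v k : U x ->
  'd tau x v 0 k = 'D_v (fun y => tau y 0 k) x.
Proof.
move=> Ux; have dt := smooth_map_differentiable Ux.
by rewrite -deriveE // derive_mx ?mxE //; exact: diff_derivable.
Qed.

Lemma jacobianE x i k : U x -> 'J tau x i k = partial i (fun y => tau y 0 k) x.
Proof. by move=> Ux; rewrite /jacobian mxE smooth_map_diffE. Qed.

Lemma partial_comp f i x : U x -> Ck_on 1 V f ->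
  partial i (f \o tau) x =
    \sum_k partial i (fun y => tau y 0 k) x * partial k f (tau x).
Proof.
move=> Ux Cf; have dt := smooth_map_differentiable Ux.
have df : differentiable f (tau x) := C1_differentiable oV (tauUV Ux) Cf.
rewrite /partial deriveE; last exact: differentiable_comp.
rewrite diff_comp //= (C1_diff _ oV (tauUV Ux) Cf); apply: eq_bigr => k _.
by rewrite smooth_map_diffE.
Qed.

Lemma Ck_comp k f : Ck_on k V f -> Ck_on k U (f \o tau).
Proof.
have cont g x : (forall y, V y -> {for y, continuous g}) -> U x ->
    {for x, continuous (g \o tau)}.
  move=> cg Ux; have ct : {for x, continuous tau}.
    exact: differentiable_continuous (smooth_map_differentiable Ux).
  exact: cvg_comp ct (cg _ (tauUV Ux)).
elim: k f => [|k IH] f Cf; move: (Cf) => [cf Hf].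
  by split=> // x Ux; exact: cont.
split=> [x Ux|]; first exact: cont.
have C1f : Ck_on 1 V f by exact: Ck_leq Cf.
case: Hf => df Hf; split=> [i x Ux|i].
  apply: diff_derivable; apply: differentiable_comp.
    exact: smooth_map_differentiable.
  exact: C1_differentiable oV (tauUV Ux) C1f.
apply: (Ck_eq (f := \sum_l (partial i (fun y => tau y 0 l) * (partial l f \o tau))))
  => //.
  by move=> y Uy; rewrite fct_sumE partial_comp.
apply: Ck_sum => // l; apply: CkM => //; last exact: IH (Hf l).
by have [_ [_]] := tau_smooth l k.+1; exact.
Qed.

Lemma smooth_comp f : smooth_on V f -> smooth_on U (f \o tau).
Proof. by move=> sf k; exact: Ck_comp. Qed.

End Composition.

(** * The ring of smooth functions on an open set *)

(* Vanishing outside [U] makes equality of functions on [U] a Leibniz equality,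
   so that the smooth functions on [U] form a ring with unit the indicator. *)
Record smooth_fn (R : realType) (m : nat) (U : set 'rV[R]_m) (oU : open U) := SmoothFn {
  smooth_fn_fun :> 'rV[R]_m -> R;
  smooth_fnP : smooth_on U smooth_fn_fun;
  smooth_fn_out : forall x, ~ U x -> smooth_fn_fun x = 0 }.

Section SmoothRing.
Variables (R : realType) (m : nat) (U : set 'rV[R]_m) (oU : open U).
Local Notation S := (smooth_fn oU).
Implicit Types (s t : S) (f : 'rV[R]_m -> R) (x : 'rV[R]_m) (i : 'I_m).

HB.instance Definition _ := gen_eqMixin S.
HB.instance Definition _ := gen_choiceMixin S.

Lemma smooth_fn_eq s t : (forall x, U x -> s x = t x) -> s = t.
Proof.
case: s t => [f sf of_] [g sg og] /= fg.
have e : f = g.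
  apply/funext => x; have [Ux|nUx] := pselect (U x); first exact: fg.
  by rewrite of_ // og.
by case: _ / e sg og fg => sg og _; congr (SmoothFn oU); exact: Prop_irrelevance.
Qed.

Definition cut f x : R := if `[< U x >] then f x else 0.

Lemma cutE f x : U x -> cut f x = f x.
Proof. by move=> Ux; rewrite /cut asboolT. Qed.

Lemma cut_smooth f : smooth_on U f -> smooth_on U (cut f).
Proof. by apply: smooth_eq => // y Uy; rewrite cutE. Qed.

Lemma cut_out f x : ~ U x -> cut f x = 0.
Proof. by move=> nUx; rewrite /cut asboolF. Qed.

Definition to_fn f (sf : smooth_on U f) : S := SmoothFn oU (cut_smooth sf) (@cut_out f).

Lemma to_fnE f (sf : smooth_on U f) x : U x -> to_fn sf x = f x.
Proof. exact: cutE. Qed.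

Definition fn_cst (c : R) : S := to_fn (fun k => Ck_cst k U c).
Definition fn_add s t : S :=
  to_fn (fun k => CkD oU (smooth_fnP s k) (smooth_fnP t k)).
Definition fn_opp s : S := to_fn (fun k => CkN oU (smooth_fnP s k)).
Definition fn_mul s t : S :=
  to_fn (fun k => CkM oU (smooth_fnP s k) (smooth_fnP t k)).

Let fn_addE s t x : U x -> fn_add s t x = s x + t x.
Proof. exact: to_fnE. Qed.
Let fn_oppE s x : U x -> fn_opp s x = - s x.
Proof. exact: to_fnE. Qed.
Let fn_mulE s t x : U x -> fn_mul s t x = s x * t x.
Proof. exact: to_fnE. Qed.
Let fn_cstE c x : U x -> fn_cst c x = c.
Proof. exact: to_fnE. Qed.

Ltac pointwise :=
  apply: smooth_fn_eq => ? ?; rewrite ?(fn_addE, fn_oppE, fn_mulE, fn_cstE) //.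

Fact fn_addA : associative fn_add. Proof. by move=> r s t; pointwise; exact: addrA. Qed.
Fact fn_addC : commutative fn_add. Proof. by move=> r s; pointwise; exact: addrC. Qed.
Fact fn_add0 : left_id (fn_cst 0) fn_add. Proof. by move=> s; pointwise; exact:
  add0r. Qed.
Fact fn_addN : left_inverse (fn_cst 0) fn_opp fn_add.
Proof. by move=> s; pointwise; exact: addNr. Qed.
HB.instance Definition _ :=
  GRing.isZmodule.Build S fn_addA fn_addC fn_add0 fn_addN.

Fact fn_mulA : associative fn_mul. Proof. by move=> r s t; pointwise; exact: mulrA. Qed.
Fact fn_mulC : commutative fn_mul. Proof. by move=> r s; pointwise; exact: mulrC. Qed.
Fact fn_mul1 : left_id (fn_cst 1) fn_mul. Proof. by move=> s; pointwise; exact: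
  mul1r. Qed.
Fact fn_mulD : left_distributive fn_mul fn_add.
Proof. by move=> r s t; pointwise; exact: mulrDl. Qed.
HB.instance Definition _ :=
  GRing.Zmodule_isComPzRing.Build S fn_mulA fn_mulC fn_mul1 fn_mulD.

Lemma fnDE s t x : U x -> (s + t) x = s x + t x. Proof. exact: fn_addE. Qed.
Lemma fnNE s x : U x -> (- s) x = - s x. Proof. exact: fn_oppE. Qed.
Lemma fnME s t x : U x -> (s * t) x = s x * t x. Proof. exact: fn_mulE. Qed.
Lemma fn0E x : U x -> (0 : S) x = 0. Proof. exact: fn_cstE. Qed.
Lemma fn1E x : U x -> (1 : S) x = 1. Proof. exact: fn_cstE. Qed.

(** The point carries its membership in U because evaluation outside U would send 1 to 0. As a ring
    morphism it commutes with sums, powers, matrix products and determinants. *)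
Definition eval_at (p : {x | U x}) (s : S) : R := s (sval p).

Fact eval_at_additive p : zmod_morphism (eval_at p).
Proof. by move=> s t; rewrite /eval_at (fnDE _ _ (svalP p)) (fnNE _ (svalP p)). Qed.
Fact eval_at_multiplicative p : monoid_morphism (eval_at p).
Proof. by split=> [|s t]; [exact: fn1E (svalP p)|exact: fnME (svalP p)]. Qed.
HB.instance Definition _ p := GRing.isZmodMorphism.Build S R (eval_at p)
  (eval_at_additive p).
HB.instance Definition _ p := GRing.isMonoidMorphism.Build S R (eval_at p)
  (eval_at_multiplicative p).

Lemma fn_sumE I (r : seq I) (P : pred I) (F : I -> S) x : U x ->
  (\sum_(k <- r | P k) F k) x = \sum_(k <- r | P k) F k x.
Proof. by move=> Ux; exact: (raddf_sum (eval_at (exist _ x Ux))). Qed.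

Lemma fn_natE k x : U x -> (k%:R : S) x = k%:R.
Proof. by move=> Ux; exact: (rmorph_nat (eval_at (exist _ x Ux))). Qed.

Lemma fn_XE s (k : nat) x : U x -> (s ^+ k) x = s x ^+ k.
Proof. by move=> Ux; exact: (rmorphXn (eval_at (exist _ x Ux))). Qed.

Definition eval_mx p q (A : 'M[S]_(p, q)) x : 'M[R]_(p, q) := map_mx (fun s : S => s
  x) A.

Lemma eval_mxM p q r (A : 'M[S]_(p, q)) (B : 'M[S]_(q, r)) x : U x ->
  eval_mx (A *m B) x = eval_mx A x *m eval_mx B x.
Proof. by move=> Ux; exact: (map_mxM (eval_at (exist _ x Ux))). Qed.

Lemma eval_mxD p q (A B : 'M[S]_(p, q)) x : U x ->
  eval_mx (A + B) x = eval_mx A x + eval_mx B x.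
Proof. by move=> Ux; apply/matrixP => i j; rewrite !mxE fnDE. Qed.

Lemma eval_mxZ p q s (A : 'M[S]_(p, q)) x : U x ->
  eval_mx (s *: A) x = s x *: eval_mx A x.
Proof. by move=> Ux; apply/matrixP => i j; rewrite !mxE fnME. Qed.

Lemma eval_mx1 p x : U x -> eval_mx (1%:M : 'M[S]_p) x = 1%:M.
Proof. by move=> Ux; exact: (map_mx1 (eval_at (exist _ x Ux))). Qed.

Lemma eval_mx_eq p q (A B : 'M[S]_(p, q)) :
  (forall x, U x -> eval_mx A x = eval_mx B x) -> A = B.
Proof.
move=> AB; apply/matrixP => i j; apply: smooth_fn_eq => x Ux.
by have /matrixP/(_ i j) := AB x Ux; rewrite !mxE.
Qed.

Lemma fn_inverse s : (forall x, U x -> s x != 0) -> exists t : S, t * s = 1.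
Proof.
move=> s0; exists (to_fn (fun k => CkV oU s0 (smooth_fnP s k))).
by apply: smooth_fn_eq => x Ux; rewrite fnME // to_fnE // fn1E // mulVf // s0.
Qed.

(** The adjugate times the inverse of the nowhere vanishing determinant, hence smooth again. *)
Lemma mx_inverse p (A : 'M[S]_p) : (forall x, U x -> eval_mx A x \in unitmx) ->
  exists B, B *m A = 1%:M.
Proof.
move=> uA; have [|t td] := @fn_inverse (\det A).
  move=> x Ux; rewrite -[_ x]/(eval_at (exist _ x Ux) (\det A)) -det_map_mx.
  by have := uA x Ux; rewrite unitmxE unitfE.
by exists (t *: \adj A); rewrite -scalemxAl mul_adj_mx scale_scalar_mx td.
Qed.

Definition fn_der i s : S := to_fn (@smooth_partial _ _ U s i (smooth_fnP s)).

Lemma fn_derE i s x : U x -> fn_der i s x = partial i s x.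
Proof. exact: to_fnE. Qed.

Lemma fn_der_eq i s f x : U x -> (forall y, U y -> f y = s y) ->
  fn_der i s x = partial i f x.
Proof. by move=> Ux fs; rewrite fn_derE //; apply/esym; exact: partial_eq oU Ux fs. Qed.

Lemma fn_der_cst i c : fn_der i (fn_cst c) = 0.
Proof.
apply: smooth_fn_eq => x Ux; rewrite (@fn_der_eq _ _ (cst c) x Ux) ?fn0E //.
  by rewrite /partial derive_cst.
by move=> y Uy; rewrite fn_cstE.
Qed.

Fact fn_derD i : {morph fn_der i : s t / s + t}.
Proof.
move=> s t; apply: smooth_fn_eq => x Ux; rewrite fnDE // !fn_derE //.
rewrite -(@partial_eq _ _ _ (s \+ t) _ _ _ oU Ux); last by move=> y Uy; rewrite fnDE.
by rewrite /partial deriveD //; apply: smooth_derivable Ux => //; exact: smooth_fnP.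
Qed.

Fact fn_derM i s t : fn_der i (s * t) = fn_der i s * t + s * fn_der i t.
Proof.
apply: smooth_fn_eq => x Ux; rewrite fnDE // !fnME // !fn_derE //.
rewrite -(@partial_eq _ _ _ (s \* t) _ _ _ oU Ux); last by move=> y Uy; rewrite fnME.
rewrite /partial deriveM; first by rewrite addrC /= mulrC.
all: by apply: smooth_derivable Ux => //; exact: smooth_fnP.
Qed.

Fact fn_derC i j s : fn_der i (fn_der j s) = fn_der j (fn_der i s).
Proof.
have e k l x : U x -> fn_der k (fn_der l s) x = partial k (partial l s) x.
  by move=> Ux; apply: fn_der_eq => // y Uy; rewrite fn_derE.
apply: smooth_fn_eq => x Ux; apply: (etrans (e i j x Ux)).
exact: (etrans (partialC i j oU Ux (smooth_fnP s)) (esym (e j i x Ux))).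
Qed.

Definition fn_ders : derivations S m := Derivations fn_derD fn_derM fn_derC.

Definition fn_half : S := fn_cst 2^-1.

Lemma fn_halfP : fn_half + fn_half = 1.
Proof.
apply: smooth_fn_eq => x Ux; rewrite fnDE // fn1E // fn_cstE //.
by rewrite [RHS]splitr div1r.
Qed.

End SmoothRing.

(** * Transfer between coordinate expressions and the ring of smooth functions *)

Lemma derive_pull (R : realType) (m n : nat) (pull : 'rV[R]_m -> 'rV[R]_n)
    (f : 'rV[R]_n -> R) (v : 'rV[R]_m) (w : 'rV[R]_n) z :
  (forall h, pull (h *: v + z) = h *: w + pull z) ->
  'D_v (f \o pull) z = 'D_w f (pull z).
Proof.
move=> pullE.
have E : (fun h : R => h^-1 *: (((f \o pull) \o shift z) (h *: v) - (f \o pull) z)) =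
    (fun h : R => h^-1 *: ((f \o shift (pull z)) (h *: w) - f (pull z))).
  by apply/funext => h /=; rewrite pullE.
by rewrite /derive E.
Qed.

Section Transfer.
Variables (R : realType) (m n : nat) (U : set 'rV[R]_m) (oU : open U).
Variables (pull : 'rV[R]_m -> 'rV[R]_n) (e : 'I_n -> 'I_m).
Hypothesis pullE : forall i h z,
  pull (h *: delta_mx 0 (e i) + z) = h *: delta_mx 0 i + pull z.
Local Notation S := (smooth_fn oU).
Variable D : derivations S n.
Hypothesis DE : forall i s, D i s = fn_der (e i) s.

(** With [pull] the identity this describes the geometry of the chart itself; with [pull] the
    projection [x_coord] it describes base geometry inside the ambient ring. *)
Definition represents (f : 'rV[R]_n -> R) (s : S) :=
  forall z, U z -> f (pull z) = s z.

Lemma rep_partial i f s : represents f s -> represents (partial i f) (D i s).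
Proof.
move=> fs z Uz; rewrite DE; apply/esym; apply: (etrans (@fn_der_eq _ _ _ _ (e i) s (f
  \o pull) z Uz fs)).
by apply: derive_pull => h; exact: pullE.
Qed.

Variables (g : 'rV[R]_n -> 'M[R]_n) (G Gi : 'M[S]_n).
Hypothesis gG : forall a b, represents (fun y => g y a b) (G a b).
Hypothesis GiG : Gi *m G = 1%:M.

Let h : S := fn_half oU.
Let Gam := christ_conn D h Gi G.

Lemma eval_metric z : U z -> eval_mx G z = g (pull z).
Proof. by move=> Uz; apply/matrixP => a b; rewrite mxE -gG. Qed.

Lemma rep_ginv z : U z -> ginv g (pull z) = eval_mx Gi z.
Proof.
move=> Uz; have e1 : eval_mx Gi z *m g (pull z) = 1%:M.
  by rewrite -eval_metric // -eval_mxM // GiG eval_mx1.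
have [_ ug] := mulmx1_unit e1.
by rewrite /ginv -[LHS]mul1mx -e1 mulmxK.
Qed.

Lemma rep_ginvE k l : represents (fun y => ginv g y k l) (Gi k l).
Proof. by move=> z Uz; rewrite rep_ginv // mxE. Qed.

Lemma rep_christoffel k i j :
  represents (christoffel g k i j) (christ D h Gi G k i j).
Proof.
move=> z Uz; rewrite /christoffel /christ fnME // fn_sumE // to_fnE //.
congr (_ * _); apply: eq_bigr => l _; rewrite fnME // fnDE // fnNE // fnDE //.
rewrite rep_ginvE //.
by rewrite -(rep_partial i (gG j l) Uz) -(rep_partial j (gG i l) Uz)
  -(rep_partial l (gG i j) Uz).
Qed.

Lemma rep_conn k i j : represents (christoffel g k i j) (Gam i j k).
Proof. by move=> z Uz; rewrite rep_christoffel // /Gam mxE. Qed.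

Lemma rep_riemann l k i j : represents (riemann g l k i j) (curv D Gam i j k l).
Proof.
move=> z Uz; rewrite /riemann (rep_partial i (rep_conn l j k) Uz).
rewrite (rep_partial j (rep_conn l i k) Uz) curvE.
rewrite fnDE // fnNE // fnDE // fnDE // fnNE // !fn_sumE // sumrB addrA.
congr (_ + _ - _); apply: eq_bigr => s _; rewrite fnME //.
  by rewrite !(rep_conn _ _ _ Uz) mulrC.
by rewrite !(rep_conn _ _ _ Uz) mulrC.
Qed.

Lemma rep_ricci j k : represents (fun y => ricci g y j k) (ric D Gam j k).
Proof.
move=> z Uz; rewrite !mxE fn_sumE //; apply: eq_bigr => i _.
exact: rep_riemann.
Qed.

Lemma rep_scal : represents (scalar_curvature g) (scal D Gam Gi).
Proof.
move=> z Uz; rewrite /scalar_curvature /scal fn_sumE //; apply: eq_bigr => i _.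
rewrite fn_sumE //; apply: eq_bigr => j _.
by rewrite fnME // rep_ginvE // (rep_ricci i j Uz).
Qed.

Variables (f : 'rV[R]_n -> R) (s : S) (lambda : R).
Hypothesis fs : represents f s.
Let lam : S := fn_cst oU lambda.

Lemma rep_hess i j : represents (fun y => hessian g f y i j) (hess D Gam s i j).
Proof.
move=> z Uz; rewrite mxE [X in _ = smooth_fn_fun X _]mxE fnDE // fnNE // fn_sumE //.
rewrite (rep_partial i (rep_partial j fs) Uz); congr (_ - _).
by apply: eq_bigr => k _; rewrite fnME // (rep_conn k i j Uz) (rep_partial k fs Uz).
Qed.

Lemma rep_lap :
  represents (laplacian g f) (\sum_i \sum_j Gi i j * hess D Gam s i j).
Proof.
move=> z Uz; rewrite /laplacian fn_sumE //; apply: eq_bigr => i _.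
rewrite fn_sumE //; apply: eq_bigr => j _.
by rewrite fnME // rep_ginvE // (rep_hess i j Uz).
Qed.

Lemma rep_gsq : represents (grad_sqnorm g f) (gsq D Gi s).
Proof.
move=> z Uz; rewrite /grad_sqnorm /gsq fn_sumE //; apply: eq_bigr => i _.
rewrite fn_sumE //; apply: eq_bigr => j _.
by rewrite !fnME // rep_ginvE // (rep_partial i fs Uz) (rep_partial j fs Uz).
Qed.

Lemma rep_P a b :
  represents (fun y => P_loc g f lambda y a b) (Pmx D Gam G lam s a b).
Proof.
move=> z Uz; rewrite PmxE !(fnDE, fnNE, fnME) // to_fnE //.
rewrite -(rep_ricci a b Uz) -(rep_hess a b Uz) -(gG a b Uz) /P_loc.
by move: (ricci g _) (hessian g f _) => A B; rewrite !mxE.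
Qed.

Lemma rep_Y : represents (Y_loc g f lambda) (Ypot D h Gam Gi lam s).
Proof.
move=> z Uz; rewrite /Y_loc /Ypot.
rewrite fnME // fnNE // fnDE // fnDE // fnNE // fnME // fnME // fn_natE //.
by rewrite !to_fnE // (rep_scal Uz) (rep_gsq Uz) (fs Uz).
Qed.

Lemma rep_F : represents (F_loc g f lambda)
  (\sum_i \sum_j Gi i j * hess D Gam s i j - gsq D Gi s + 2 * lam * s - n%:R * lam).
Proof.
move=> z Uz; rewrite /F_loc (rep_lap Uz) (rep_gsq Uz) (fs Uz).
rewrite fnDE // fnNE // fnDE // fnDE // fnNE //.
by rewrite [in RHS]fnME // [in RHS]fnME // [in RHS]fnME // !fn_natE // to_fnE.
Qed.

End Transfer.

(** * Signature *)

Section Signature.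
Variable R : realType.

Lemma posdef_unit n (B : 'M[R]_n) : posdef B -> B \in unitmx.
Proof.
move=> pB; rewrite -row_free_unit -kermx_eq0; apply/eqP/row_matrixP => i.
rewrite row0; apply/eqP; apply: contraT => /pB.
by rewrite -row_mul mulmx_ker row0 mul0mx mxE ltxx.
Qed.

Lemma posdef_congr n (B T : 'M[R]_n) : T \in unitmx -> posdef B ->
  posdef (T *m B *m T^T).
Proof.
move=> uT pB w w0; have : 0 < (w *m T *m B *m (w *m T)^T) ord0 ord0.
  by apply: pB; apply: contra w0 => /eqP e; rewrite -[w](mulmxK uT) e mul0mx.
by rewrite trmx_mul !mulmxA.
Qed.

(** Symmetric Gauss elimination: the positive corner a clears its row and column, the Schur
    complement [E'] is again positive definite, and a is rescaled by its square root. *)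
Lemma posdef_normal_form n (B : 'M[R]_n) : B^T = B -> posdef B ->
  exists T : 'M[R]_n, T *m B *m T^T = 1%:M.
Proof.
elim: n B => [|n IH] B BT pB; first by exists 1%:M; apply/matrixP => [[]].
pose a := B ord0 ord0.
have a0 : 0 < a.
  have e : (delta_mx ord0 ord0 : 'rV[R]_n.+1) != 0.
    apply/eqP => /matrixP/(_ ord0 ord0); rewrite !mxE !eqxx => /eqP.
    by rewrite oner_eq0.
  by have := pB _ e; rewrite -rowE trmx_delta -colE !mxE.
have an0 : a != 0 by rewrite gt_eqF.
pose b : 'rV[R]_n := ursubmx (B : 'M[R]_(1 + n)).
pose E : 'M[R]_n := drsubmx (B : 'M[R]_(1 + n)).
have BE : B = block_mx a%:M b b^T E :> 'M[R]_(1 + n).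
  rewrite -[LHS](@submxK _ 1 n 1 n); congr block_mx.
    by apply/matrixP => i j; rewrite !mxE !ord1 eqxx; congr (B _ _); exact: val_inj.
  by rewrite /b trmx_ursub; congr dlsubmx; exact: esym BT.
pose T1 : 'M[R]_(1 + n) := block_mx 1%:M 0 (- a^-1 *: b^T) 1%:M.
have uT1 : T1 \in unitmx by rewrite unitmxE det_lblock !det1 mulr1 unitr1.
pose E' := E - a^-1 *: (b^T *m b).
have T1B : T1 *m (B : 'M[R]_(1 + n)) *m T1^T = block_mx a%:M 0 0 E'.
  rewrite {1}BE /T1 tr_block_mx !mulmx_block !trmx1 trmx0 linearZ /= trmxK.
  rewrite !(mul1mx, mul0mx, mulmx1, mulmx0, addr0, add0r).
  have e1 : a%:M *m (- a^-1 *: b) + b = 0.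
    by rewrite mul_scalar_mx scalerA mulrN mulfV // scaleN1r addNr.
  have e2 : (- a^-1 *: b^T) *m a%:M + b^T = 0.
    by rewrite mul_mx_scalar scalerA mulrN mulfV // scaleN1r addNr.
  rewrite e1 e2 mul0mx add0r; congr block_mx.
  by rewrite /E' addrC -scalemxAl scaleNr.
have E'T : E'^T = E'.
  rewrite /E' raddfB /= linearZ /= trmx_mul trmxK; congr (_ - _).
  by rewrite /E trmx_drsub; congr drsubmx.
have pE' : posdef E'.
  move=> w w0; have := posdef_congr uT1 pB; rewrite T1B => /(_ (row_mx 0 w)).
  rewrite tr_row_mx mul_row_block mul_row_col !mul0mx add0r trmx0 mulmx0 add0r.
  rewrite add0r; apply.
  by apply: contra w0 => /eqP/(congr1 rsubmx); rewrite row_mxKr linear0 => ->.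
have [T2 T2E] := IH _ E'T pE'.
pose T0 : 'M[R]_(1 + n) := block_mx (Num.sqrt a)^-1%:M 0 0 T2.
have T0E : T0 *m (block_mx a%:M 0 0 E' : 'M[R]_(1 + n)) *m T0^T = 1%:M.
  rewrite tr_block_mx !mulmx_block !trmx0 !(mul0mx, mulmx0, addr0, add0r) T2E.
  rewrite tr_scalar_mx -!scalar_mxM.
  have sa0 : Num.sqrt a != 0 by rewrite gt_eqF // sqrtr_gt0.
  have -> : (Num.sqrt a)^-1 * a * (Num.sqrt a)^-1 = 1.
    by rewrite -{2}[a]sqr_sqrtr ?ltW // expr2 mulrA mulVf // mul1r mulfV.
  by rewrite -scalar_mx_block.
by exists (T0 *m T1); rewrite -T0E -T1B trmx_mul !mulmxA.
Qed.

(* The basis e_v + e_u/2, e_v - e_u/2 diagonalizes the hyperbolic plane. *)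
Lemma ambient_mx_signature n (A : 'M[R]_n) : A^T = A -> posdef A ->
  has_signature n.+1 1 (ambient_mx A).
Proof.
move=> AT pA; split; first by rewrite add1n.
have [T TA] := posdef_normal_form AT pA.
pose T' : 'M[R]_(1 + n + 1) := \matrix_(b, c) match kind_of b, kind_of c with
  | KindV, KindV => 1 | KindV, KindU => 2^-1
  | KindU, KindV => 1 | KindU, KindU => - 2^-1
  | KindX i, KindX j => T i j
  | _, _ => 0 end.
pose I' := diag_mx (\row_(k < 1 + n + 1) (if (k < n.+1)%N then 1 else -1 : R)).
have I'I' : I' *m I' = 1%:M.
  rewrite mulmx_diag -diag_const_mx; congr diag_mx; apply/rowP => k; rewrite !mxE.
  by case: ifP => _; ring.
have T'A : T' *m ambient_mx A *m T'^T = I'.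
  apply/matrixP => b c; rewrite mxE ambient_sum.
  have TAE b' c' : (T' *m ambient_mx A) b' c' = match kind_of c' with
     | KindV => T' b' (uI n) | KindU => T' b' (vI n)
     | KindX j => \sum_i T' b' (xI i) * A i j end.
    rewrite mxE ambient_sum !ambient_mxE !kindE.
    under eq_bigr do rewrite ambient_mxE kindE.
    by case: (kind_of c') => [|j|]; under eq_bigr do rewrite ?zeroE;
      rewrite ?big1_eq ?zeroE.
  have T'E b' c' : T' b' c' = match kind_of b', kind_of c' with
      | KindV, KindV => 1 | KindV, KindU => 2^-1
      | KindU, KindV => 1 | KindU, KindU => - 2^-1
      | KindX i, KindX j => T i j
      | _, _ => 0 end by rewrite mxE.
  have sumX b' c' : \sum_j (\sum_i T' b' (xI i) * A i j) * T' c' (xI j) =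
      match kind_of b', kind_of c' with KindX i, KindX j => (i == j)%:R | _, _ => 0 end.
    under eq_bigr do rewrite T'E kindE.
    under eq_bigr do under eq_bigr do rewrite T'E kindE.
    case: (kind_of b') => [|k|]; case: (kind_of c') => [|l|] /=; last first.
    all: try by rewrite big1 // => j _; rewrite ?mulr0 // big1 ?mul0r // => i _;
      rewrite mul0r.
    have /matrixP/(_ k l) := TA; rewrite [RHS]mxE mxE => <-.
    by apply: eq_bigr => j _; rewrite !mxE.
  rewrite !TAE !kindE; under eq_bigr do rewrite TAE kindE [T'^T _ _]mxE.
  rewrite sumX ![T'^T _ _]mxE !T'E !kindE [RHS]mxE ambient_eqE mxE.
  (* In the order v, x, u exactly the last index fails to be below n + 1, so the negative sign falls
     on u. *)
  have kv : (vI n < n.+1)%N by [].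
  have kx (i : 'I_n) : (xI i < n.+1)%N by rewrite /= ltnS add1n ltn_ord.
  have ku : (uI n < n.+1)%N = false by rewrite /= add1n addn0 ltnn.
  elim/ambient_index_ind: b => [|i|]; elim/ambient_index_ind: c => [|j|];
    rewrite ?(kv, kx, ku) ?kindE /= ?mulr1n ?mulr0n.
  1-4,6-9: lra.
  by rewrite !mul0r add0r addr0.
exists T' => //.
(* The sign matrix is an involution, which yields an explicit right inverse of [T']. *)
have [] // := @mulmx1_unit _ _ T' (ambient_mx A *m T'^T *m I').
by rewrite !mulmxA T'A I'I'.
Qed.
End Signature.

(** * Charts and tensoriality *)

Section Charts.
Variables (R : realType) (m : nat) (M : topologicalType) (A : atlas R m M).
Hypothesis mA : is_manifold A.
Implicit Types (i j : chart A) (W : set M).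

Lemma chart_imageE i W x : chart_image i W x <->
  chart_image i setT x /\ W (chart_param i x).
Proof.
split=> [[p [ip Wp] <-]|[[p [ip _] <-] Wp]].
  by split; [exists p|rewrite (mf_coordK mA)].
by exists p => //; rewrite (mf_coordK mA) in Wp.
Qed.

Lemma chart_dom_param i x : chart_image i setT x -> chart_dom i (chart_param i x).
Proof. by move=> [p [ip _] <-]; rewrite (mf_coordK mA). Qed.

Lemma chart_paramK i x : chart_image i setT x ->
  chart_coord i (chart_param i x) = x.
Proof. by move=> [p [ip _] <-]; rewrite (mf_coordK mA). Qed.

Lemma chart_image_coord i W p : chart_dom i p -> W p ->
  chart_image i W (chart_coord i p).
Proof. by move=> ip Wp; exists p. Qed.

Lemma chart_image_setT_open i : open (chart_image i setT).
Proof. by rewrite /chart_image setIT; exact: mf_image_open mA i. Qed.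

Lemma chart_param_continuous i x : chart_image i setT x ->
  {for x, continuous (chart_param i)}.
Proof.
move=> ix; have := @mf_param_continuous _ _ _ _ mA i.
have -> : chart_coord i @` chart_dom i = chart_image i setT by rewrite /chart_image
  setIT.
move=> /subspace_continuousP/(_ x ix); rewrite within_interior //; have :=
  @chart_image_setT_open i.
by rewrite openE; apply.
Qed.

Lemma chart_image_open i W : open W -> open (chart_image i W).
Proof.
move=> oW; rewrite openE => x /chart_imageE[ix Wx].
have n1 : nbhs x (chart_image i setT).
  by apply: open_nbhs_nbhs; split; [exact: chart_image_setT_open|].
have n2 : nbhs x (chart_param i @^-1` W).
  by apply: (chart_param_continuous ix); exact: open_nbhs_nbhs.
by apply: filterS (filterI n1 n2) => y [iy Wy]; apply/chart_imageE.
Qed.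
End Charts.

(** * Transformation of P and g_u and invariance of Y between charts *)

Section Tensoriality.
Variables (R : realType) (n : nat) (M : topologicalType) (A : atlas R n M).
Variables (g : tensor2 A) (phi : M -> R) (lambda : R).
Hypothesis hM : is_manifold_with_density g phi.
Let mA : is_manifold A := md_manifold hM.
Implicit Types (i j : chart A).

Lemma metric_unit i x : chart_image i setT x -> g i x \in unitmx.
Proof. by move=> ix; apply: posdef_unit; exact: (md_metric_riemannian hM ix).2. Qed.

Section TwoCharts.
Variables i j : chart A.
Let U := chart_image i (chart_dom j).
Let V := chart_image j setT.
Let tau := transition i j.
Let oU : open U := @chart_image_open _ _ _ _ mA i _ (@mf_dom_open _ _ _ _ mA j).
Let oV : open V := @chart_image_setT_open _ _ _ _ mA j.

Let UVi x : U x -> chart_image i setT x.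
Proof. by case/(chart_imageE mA). Qed.

Let tauUV x : U x -> V (tau x).
Proof.
by move=> /(chart_imageE mA)[_ jx]; rewrite /V /tau /transition /=; exact:
  chart_image_coord.
Qed.

Let tau_smooth k : smooth_on U (fun x => tau x 0 k).
Proof. exact: (mf_transition_smooth mA). Qed.

Let param_tau x : U x -> chart_param j (tau x) = chart_param i x.
Proof. by move=> /(chart_imageE mA)[_ jx]; rewrite /tau /transition /= (mf_coordK
  mA). Qed.

Let S := smooth_fn oU.
Let T := smooth_fn oV.
Let pb (t : T) : S := to_fn oU (smooth_comp oU oV tauUV tau_smooth (smooth_fnP t)).

Let pbE t x : U x -> pb t x = t (tau x).
Proof. by move=> Ux; rewrite to_fnE. Qed.

Let pbD : {morph pb : s t / s + t}.
Proof.
move=> s t; apply: smooth_fn_eq => x Ux.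
by rewrite fnDE // !pbE // fnDE //; exact: tauUV.
Qed.

Let pbM : {morph pb : s t / s * t}.
Proof.
move=> s t; apply: smooth_fn_eq => x Ux.
by rewrite fnME // !pbE // fnME //; exact: tauUV.
Qed.

Let tau_el k : S := to_fn oU (tau_smooth k).
Let D := fn_ders oU.
Let E := fn_ders oV.
Let J : 'M[S]_n := \matrix_(a, b) D a (tau_el b).

Let JxE a b x : U x -> J a b x = partial a (fun y => tau y 0 b) x.
Proof.
move=> Ux; rewrite mxE.
by apply: (@fn_der_eq _ _ _ oU a (tau_el b) (fun y => tau y 0 b) x Ux) => y Uy;
  rewrite to_fnE.
Qed.

Let JE x : U x -> eval_mx J x = 'J tau x.
Proof.
move=> Ux; apply/matrixP => a b; rewrite (jacobianE oU tau_smooth a b Ux) -JxE //.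
by rewrite [LHS]mxE.
Qed.

Let partial_tau f a x : U x -> smooth_on V f ->
  partial a (f \o tau) x = \sum_k 'J tau x a k * partial k f (tau x).
Proof.
move=> Ux sf; rewrite (partial_comp oU oV tauUV tau_smooth a Ux (sf 1%N)).
by apply: eq_bigr => k _; rewrite (jacobianE oU tau_smooth a k Ux).
Qed.

Let chain a t : D a (pb t) = \sum_k J a k * pb (E k t).
Proof.
apply: smooth_fn_eq => x Ux; rewrite fn_sumE //.
rewrite (@fn_der_eq _ _ _ oU a (pb t) (t \o tau) x Ux); last first.
  by move=> y Uy; rewrite pbE.
rewrite partial_tau //; last exact: smooth_fnP.
apply: eq_bigr => k _; rewrite fnME // pbE // fn_derE //; last exact: tauUV.
by rewrite -JE // [eval_mx _ _ _ _]mxE.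
Qed.

Let J_closed a b c : D a (J b c) = D b (J a c).
Proof. by rewrite !mxE derC. Qed.

Let idE p (a : 'I_p) (h : R) (z : 'rV[R]_p) :
  id (h *: delta_mx 0 (id a) + z) = h *: delta_mx 0 a + id z. Proof. by []. Qed.

Let el_i a b : exists s : S, forall x, U x -> g i x a b = s x.
Proof.
have sm : smooth_on U (fun x => g i x a b).
  by move=> k; apply: Ck_sub ((md_metric_smooth hM).2 i a b k) => x /UVi.
by exists (to_fn oU sm) => x Ux; rewrite to_fnE.
Qed.

Let el_j a b : exists s : T, forall x, V x -> g j x a b = s x.
Proof.
by exists (to_fn oV ((md_metric_smooth hM).2 j a b)) => x Ux; rewrite to_fnE.
Qed.

Lemma metric_tau x : U x -> g i x = 'J tau x *m g j (tau x) *m ('J tau x)^T.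
Proof.
move=> /(chart_imageE mA)[[p [ip _] <-] jp]; rewrite (mf_coordK mA) // in jp.
have := (md_metric_smooth hM).1 i j p I ip jp => /= ->.
by have -> : tau (chart_coord i p) = chart_coord j p by rewrite /tau /transition /=
  (mf_coordK mA).
Qed.

Lemma jacobian_tau_unit x : U x -> 'J tau x \in unitmx.
Proof.
move=> Ux; have := metric_unit (UVi Ux); rewrite metric_tau // -mulmxA unitmx_mul.
by case/andP.
Qed.

Lemma hessian_tau x : U x ->
  hessian (g i) (phi \o chart_param i) x =
  'J tau x *m hessian (g j) (phi \o chart_param j) (tau x) *m ('J tau x)^T.
Proof.
move=> Ux.
have [Gf Gfi] : exists Gf : 'I_n -> 'I_n -> S, forall a b x, U x -> g i x a b = Gf a
  b x.
  by exists (fun a b => sval (cid (el_i a b))) => a b; exact: svalP (cid (el_i a b)).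
have [Gf' Gfj] : exists Gf : 'I_n -> 'I_n -> T, forall a b x, V x -> g j x a b = Gf a
  b x.
  by exists (fun a b => sval (cid (el_j a b))) => a b; exact: svalP (cid (el_j a b)).
pose G : 'M[S]_n := \matrix_(a, b) Gf a b.
pose G' : 'M[T]_n := \matrix_(a, b) Gf' a b.
have repG a b : represents id (fun y => g i y a b) (G a b).
  by move=> y Uy; rewrite mxE Gfi.
have repG' a b : represents id (fun y => g j y a b) (G' a b).
  by move=> y Uy; rewrite mxE Gfj.
have evG y : U y -> eval_mx G y = g i y.
  by move=> Uy; apply/matrixP => a b; rewrite !mxE Gfi.
have evG' y : V y -> eval_mx G' y = g j y.
  by move=> Uy; apply/matrixP => a b; rewrite !mxE Gfj.
have [|Gi GiG] := @mx_inverse _ _ _ oU _ G.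
  by move=> y Uy; rewrite evG //; apply: metric_unit; exact: UVi.
have [|Gi' GiG'] := @mx_inverse _ _ _ oV _ G'.
  by move=> y Uy; rewrite evG' //; exact: metric_unit.
have GT : G^T = G.
  apply/matrixP => a b; rewrite mxE; apply: smooth_fn_eq => y Uy.
  by rewrite -!repG //= -[in RHS](md_metric_riemannian hM (UVi Uy)).1 mxE.
have GT' : G'^T = G'.
  apply/matrixP => a b; rewrite mxE; apply: smooth_fn_eq => y Uy.
  by rewrite -!repG' //= -[in RHS](md_metric_riemannian hM Uy).1 mxE.
pose s : T := to_fn oV (md_phi_smooth hM j).
have reps' : represents id (phi \o chart_param j) s by move=> y Vy; rewrite to_fnE.
have reps : represents id (phi \o chart_param i) (pb s).
  by move=> y Uy; rewrite pbE // -reps' ?param_tau //=; [rewrite param_tau|exact: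
    tauUV].
have GE : G = J *m map_mx pb G' *m J^T.
  apply: eval_mx_eq => y Uy; rewrite !eval_mxM // evG // JE // metric_tau //.
  congr (_ *m _ *m _); last by rewrite -JE //; apply/matrixP => a b; rewrite !mxE.
  by rewrite -(evG' _ (tauUV Uy)); apply/matrixP => a b; rewrite !mxE pbE.
have hc := hess_change pbD pbM chain J_closed (fn_halfP oU) GT GiG
  (christ_torsion_free D (fn_half oU) Gi GT)
  (christ_metric_compat D (fn_halfP oU) GiG GT)
  (christ_torsion_free E (fn_half oV) Gi' GT')
  (christ_metric_compat E (fn_halfP oV) GiG' GT') GE s.
have := congr1 (fun X => eval_mx X x) hc; rewrite !eval_mxM // JE //.
have -> : eval_mx J^T x = ('J tau x)^T by rewrite -JE //; apply/matrixP => a b;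
  rewrite !mxE.
have -> : eval_mx (hess D (christ_conn D (fn_half oU) Gi G) (pb s)) x =
    hessian (g i) (phi \o chart_param i) x.
  apply/matrixP => a b; rewrite [LHS]mxE.
  exact: esym (rep_hess (pull := id) (e := id) (@idE n) (D := D) (fun _ _ => erefl)
    repG GiG reps a b Ux).
move=> ->; congr (_ *m _ *m _); apply/matrixP => a b; rewrite [LHS]mxE [map_mx pb _ a
  b]mxE pbE //.
exact: esym (rep_hess (pull := id) (e := id) (@idE n) (D := E) (fun _ _ => erefl)
  repG' GiG' reps' a b (tauUV Ux)).
Qed.

Lemma grad_tau a x : U x -> partial a (phi \o chart_param i) x =
  \sum_k 'J tau x a k * partial k (phi \o chart_param j) (tau x).
Proof.
move=> Ux; rewrite -(partial_tau a Ux (md_phi_smooth hM j)).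
by apply: partial_eq oU Ux _ => y Uy /=; rewrite param_tau.
Qed.

(** A full contraction with the inverse metric is a trace, on which the change of frame acts by
    conjugation. Scalar curvature and squared gradient are both of this form. *)
Lemma contract_congr (J0 B T0 : 'M[R]_n) : J0 \in unitmx -> B \in unitmx ->
  \sum_a \sum_b invmx (J0 *m B *m J0^T) a b * (J0 *m T0 *m J0^T) a b =
  \sum_a \sum_b invmx B a b * T0 a b.
Proof.
move=> uJ uB; have contractE (X Z : 'M[R]_n) :
    \sum_a \sum_b X a b * Z a b = \tr (X *m Z^T).
  by apply: eq_bigr => a _; rewrite mxE; apply: eq_bigr => b _; rewrite mxE.
rewrite !contractE !trmx_mul trmxK.
have -> : invmx (J0 *m B *m J0^T) = invmx J0^T *m invmx B *m invmx J0.
  have uJT : J0^T \in unitmx by rewrite unitmx_tr.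
  have e : (J0 *m B *m J0^T) *m (invmx J0^T *m invmx B *m invmx J0) = 1%:M.
    by rewrite !mulmxA mulmxK // mulmxK // mulmxV.
  have [uX _] := mulmx1_unit e.
  by rewrite -[LHS]mulmx1 -e mulKmx.
rewrite !mulmxA -(mulmxA _ (invmx J0)) mulVmx // mulmx1.
by rewrite mxtrace_mulC !mulmxA mulmxV ?mul1mx // unitmx_tr.
Qed.

Hypothesis hcase : gradient_ricci_soliton g phi lambda \/ is_flat g.

Lemma ricci_tau x : U x ->
  ricci (g i) x = 'J tau x *m ricci (g j) (tau x) *m ('J tau x)^T.
Proof.
move=> Ux; case: hcase => [sol|fl].
  have e k y : chart_image k setT y -> ricci (g k) y =
      lambda *: g k y - hessian (g k) (phi \o chart_param k) y.
    by move=> /(sol k) /eqP; rewrite /P_phi /P_loc subr_eq0 => /eqP <-; rewrite addrK.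
  rewrite (e i _ (UVi Ux)) (e j _ (tauUV Ux)) hessian_tau // metric_tau //.
  by rewrite mulmxBr mulmxBl -scalemxAr -scalemxAl.
have e k y : chart_image k setT y -> ricci (g k) y = 0.
  by move=> ky; apply/matrixP => a b; rewrite !mxE big1 // => l _; exact: fl.
by rewrite (e i _ (UVi Ux)) (e j _ (tauUV Ux)) mulmx0 mul0mx.
Qed.

Lemma P_tau x : U x -> P_phi g phi lambda i x =
  'J tau x *m P_phi g phi lambda j (tau x) *m ('J tau x)^T.
Proof.
move=> Ux; rewrite /P_phi /P_loc ricci_tau // hessian_tau // metric_tau //.
by rewrite mulmxBr mulmxBl -scalemxAr -scalemxAl mulmxDr mulmxDl.
Qed.

Lemma Y_tau x : U x -> Y_loc (g i) (phi \o chart_param i) lambda x =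
  Y_loc (g j) (phi \o chart_param j) lambda (tau x).
Proof.
move=> Ux; have uJ := jacobian_tau_unit Ux; have ug := metric_unit (tauUV Ux).
have cE := contract_congr _ uJ ug.
have e1 : scalar_curvature (g i) x = scalar_curvature (g j) (tau x).
  by rewrite /scalar_curvature /ginv (metric_tau Ux) (ricci_tau Ux) cE.
have e2 : grad_sqnorm (g i) (phi \o chart_param i) x =
    grad_sqnorm (g j) (phi \o chart_param j) (tau x).
  pose w (k : chart A) y : 'cV[R]_n := \col_a partial a (phi \o chart_param k) y.
  have wE k y : grad_sqnorm (g k) (phi \o chart_param k) y =
      \sum_a \sum_b invmx (g k y) a b * (w k y *m (w k y)^T) a b.
    apply: eq_bigr => a _; apply: eq_bigr => b _.
    by rewrite [X in _ = _ * X]mxE big_ord1 [(w k y)^T _ _]mxE !mxE mulrA.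
  have wJ : w i x = 'J tau x *m w j (tau x).
    apply/matrixP => a b; rewrite mxE (grad_tau a Ux) mxE.
    by apply: eq_bigr => k _; rewrite [w _ _ _ _]mxE.
  by rewrite !wE (metric_tau Ux) wJ trmx_mul !mulmxA -(mulmxA _ (w j _)) cE.
have e3 : (phi \o chart_param i) x = (phi \o chart_param j) (tau x).
  by rewrite /= (param_tau Ux).
by rewrite /Y_loc e1 e2 e3.
Qed.

(** Solved for the second chart, the form needed between the two transformed copies of P in the
    quadratic term of g_u. *)
Lemma ginv_tau x : U x ->
  ('J tau x)^T *m ginv (g i) x *m 'J tau x = ginv (g j) (tau x).
Proof.
move=> Ux; have uJ := jacobian_tau_unit Ux; have ug := metric_unit (tauUV Ux).
have uJT : ('J tau x)^T \in unitmx by rewrite unitmx_tr.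
rewrite /ginv metric_tau //; set J0 := 'J tau x in uJ uJT *; set B := g j _ in ug *.
have uJB : J0 *m B *m J0^T \in unitmx by rewrite !unitmx_mul uJ ug.
have e : B *m (J0^T *m invmx (J0 *m B *m J0^T) *m J0) = 1%:M.
  rewrite -[LHS](mulKmx uJ).
  have -> : J0 *m (B *m (J0^T *m invmx (J0 *m B *m J0^T) *m J0)) =
      J0 *m B *m J0^T *m invmx (J0 *m B *m J0^T) *m J0 by rewrite !mulmxA.
  by rewrite mulmxV // mul1mx mulVmx.
by rewrite -[RHS]mulmx1 -e mulKmx.
Qed.

Lemma g_u_tau w x : U x -> g_u g phi lambda w i x =
  'J tau x *m g_u g phi lambda w j (tau x) *m ('J tau x)^T.
Proof.
move=> Ux; rewrite /g_u -ginv_tau // metric_tau // P_tau //.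
move: (P_phi g phi lambda j _) (g j _) (ginv (g i) x) => P B C.
by rewrite !mulmxDr !mulmxDl -!scalemxAr -!scalemxAl !mulmxA.
Qed.

End TwoCharts.

(** The preferred chart in the definition of [Y_phi] may jump from point to point; only this formula
    in a fixed chart shows that [Y_phi] is smooth and can be differentiated. *)
Lemma Y_phi_chart i x : gradient_ricci_soliton g phi lambda \/ is_flat g ->
  chart_image i setT x ->
  Y_phi g phi lambda (chart_param i x) =
  Y_loc (g i) (phi \o chart_param i) lambda x.
Proof.
move=> hcase ix; rewrite /Y_phi; set j := chart_at A _.
have Ux : chart_image i (chart_dom j) x.
  by apply/(chart_imageE mA); split => //; exact: (mf_chart_at mA).
exact: esym (Y_tau hcase Ux).
Qed.
End Tensoriality.

(** * Product coordinates (v, x, u) and their charts *)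

Section AmbientCoordinates.
Variables (R : realType) (n : nat).
Implicit Types z : 'rV[R]_(1 + n + 1).

Lemma v_coordE z : v_coord z = z 0 (vI n).
Proof. by rewrite /v_coord !mxE. Qed.

Lemma x_coordE z k : x_coord z 0 k = z 0 (xI k).
Proof. by rewrite /x_coord !mxE. Qed.

Lemma u_coordE z : u_coord z = z 0 (uI n).
Proof. by rewrite /u_coord !mxE. Qed.

Lemma x_coord_x i h z :
  x_coord (h *: delta_mx 0 (xI i) + z) = h *: delta_mx 0 i + x_coord z.
Proof.
apply/rowP => k; rewrite x_coordE mxE [RHS]mxE x_coordE; congr (_ + _).
by rewrite !mxE ambient_eqE !kindE.
Qed.

Lemma x_coord_transverse b h z : (forall k, b != xI k) ->
  x_coord (h *: delta_mx 0 b + z) = x_coord z.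
Proof.
move=> bx; apply/rowP => k; rewrite !x_coordE !mxE eqxx /= eq_sym.
by rewrite (negbTE (bx k)) mulr0 add0r.
Qed.

Lemma x_coord_smooth U k : smooth_on U (fun z => x_coord z 0 k).
Proof.
have -> : (fun z => x_coord z 0 k) = (fun z => z 0 (xI k)).
  by apply/funext => z; rewrite x_coordE.
exact: smooth_coord.
Qed.

Lemma x_coord_continuous : continuous (@x_coord R n).
Proof.
move=> z; apply: differentiable_continuous.
by apply: (smooth_map_differentiable openT) => // k; exact: x_coord_smooth.
Qed.

Lemma v_coord_smooth U : smooth_on U (@v_coord R n).
Proof.
have -> : @v_coord R n = (fun z => z 0 (vI n)) by apply/funext => z; rewrite v_coordE.
exact: smooth_coord.
Qed.

Lemma u_coord_smooth U : smooth_on U (@u_coord R n).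
Proof.
have -> : @u_coord R n = (fun z => z 0 (uI n)) by apply/funext => z; rewrite u_coordE.
exact: smooth_coord.
Qed.
End AmbientCoordinates.

Section AmbientCharts.
Variables (R : realType) (n : nat) (M : topologicalType) (A : atlas R n M).
Hypothesis mA : is_manifold A.
Variable W : set (ambient R M).
Hypothesis oW : open W.
Implicit Types (i j : chart A) (z : 'rV[R]_(1 + n + 1)).
Local Notation img i W := (chart_image (A := ambient_atlas A) i W).

Lemma ambient_imageE i (W' : set (ambient R M)) z : img i W' z <->
  chart_image i setT (x_coord z) /\
  W' (v_coord z, chart_param i (x_coord z), u_coord z).
Proof.
split=> [[[[v p] u] /= [ip Wp] <-]|[ix Wz]].
  rewrite /x_coord /v_coord /u_coord /= !(row_mxKl, row_mxKr) !mxE (mf_coordK mA) //.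
  by split => //; exists p.
exists (v_coord z, chart_param i (x_coord z), u_coord z) => /=.
  by split => //; exact: chart_dom_param.
rewrite (chart_paramK mA ix).
have -> : const_mx (u_coord z) = rsubmx z :> 'M[R]_1.
  by apply/matrixP => a b; rewrite mxE !ord1.
have -> : const_mx (v_coord z) = lsubmx (lsubmx z) :> 'M[R]_1.
  by apply/matrixP => a b; rewrite mxE !ord1.
by rewrite !hsubmxK.
Qed.

Lemma ambient_image_open i : open (img i W).
Proof.
rewrite openE => z /ambient_imageE [ix Wz].
have n1 : nbhs z (@x_coord R n @^-1` chart_image i setT).
  have oi : open (chart_image i setT) by exact: chart_image_setT_open.
  exact: (@x_coord_continuous R n z _ (open_nbhs_nbhs (conj oi ix))).
pose F y : ambient R M := (v_coord y, chart_param i (x_coord y), u_coord y).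
have cx : @x_coord R n @ z --> x_coord z by exact: x_coord_continuous.
have cp : chart_param i @ x_coord z --> chart_param i (x_coord z).
  exact: chart_param_continuous.
have cv : @v_coord R n @ z --> v_coord z.
  by apply: (@smooth_continuous _ _ setT) => //; exact: v_coord_smooth.
have cu : @u_coord R n @ z --> u_coord z.
  by apply: (@smooth_continuous _ _ setT) => //; exact: u_coord_smooth.
have cpx : (chart_param i \o @x_coord R n) @ z --> chart_param i (x_coord z).
  exact: (cvg_comp _ _ cx cp).
have n2 : nbhs z (F @^-1` W).
  have [[B1 B2] [/= [[B3 B4] [/= nb3 nb4] B34] nb2] sub] := open_nbhs_nbhs (conj oW Wz).
  have nv : nbhs z (@v_coord R n @^-1` B3) := cv _ nb3.
  have nx : nbhs z ((chart_param i \o @x_coord R n) @^-1` B4) := cpx _ nb4.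
  have nu : nbhs z (@u_coord R n @^-1` B2) := cu _ nb2.
  apply: filterS (filterI (filterI nv nx) nu) => y [[y3 y4] y2].
  by apply: sub; split => //; exact: (B34 (v_coord y, _) (conj y3 y4)).
by apply: filterS (filterI n1 n2) => y [iy Wy]; apply/ambient_imageE.
Qed.
End AmbientCharts.

(** * Transition maps of the ambient atlas *)

Section AmbientTransition.
Variables (R : realType) (n : nat) (M : topologicalType) (A : atlas R n M).
Hypothesis mA : is_manifold A.
Variables i j : chart A.
Local Notation tau := (transition i j).
Local Notation ttau := (@transition R (1 + n + 1) (ambient R M) (ambient_atlas A) i j).
Let V := chart_image i (chart_dom j).
Let U : set 'rV[R]_(1 + n + 1) := @x_coord R n @^-1` V.

Let oV : open V := chart_image_open mA (mf_dom_open mA j).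

Let oU : open U.
Proof. by move: oV; apply: open_comp => z _; exact: x_coord_continuous. Qed.

Lemma coords_row (v : R) (x : 'rV[R]_n) (u : R) :
  let z := row_mx (row_mx (const_mx v) x) (const_mx u) : 'rV[R]_(1 + n + 1) in
  [/\ v_coord z = v, x_coord z = x & u_coord z = u].
Proof.
by rewrite /x_coord /v_coord /u_coord /= !(row_mxKl, row_mxKr) !mxE.
Qed.

Let ttau_x k : (fun z => ttau z 0 (xI k)) = (fun y => tau y 0 k) \o @x_coord R n.
Proof.
apply/funext => z; rewrite -x_coordE.
by have [_ -> _] := coords_row (v_coord z) (tau (x_coord z)) (u_coord z).
Qed.

Let ttau_v : (fun z => ttau z 0 (vI n)) = (fun z => z 0 (vI n)).
Proof.
apply/funext => z; rewrite -!v_coordE.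
by have [-> _ _] := coords_row (v_coord z) (tau (x_coord z)) (u_coord z).
Qed.

Let ttau_u : (fun z => ttau z 0 (uI n)) = (fun z => z 0 (uI n)).
Proof.
apply/funext => z; rewrite -!u_coordE.
by have [_ _ ->] := coords_row (v_coord z) (tau (x_coord z)) (u_coord z).
Qed.

Let ttau_smooth c : smooth_on U (fun z => ttau z 0 c).
Proof.
elim/ambient_index_ind: c => [|k|].
- by rewrite ttau_v; exact: smooth_coord.
- rewrite ttau_x; apply: (smooth_comp oU oV) => // [l|]; first exact: x_coord_smooth.
  exact: (mf_transition_smooth mA).
- by rewrite ttau_u; exact: smooth_coord.
Qed.

Definition ambient_jacobian (J : 'M[R]_n) : 'M[R]_(1 + n + 1) :=
  \matrix_(b, c) match kind_of b, kind_of c with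
    | KindV, KindV | KindU, KindU => 1
    | KindX k, KindX l => J k l
    | _, _ => 0
    end.

Lemma jacobian_ambient z : U z -> 'J ttau z = ambient_jacobian ('J tau (x_coord z)).
Proof.
move=> Uz; apply/matrixP => b c; rewrite (jacobianE oU ttau_smooth b c Uz) mxE.
have transverse f : (forall k, b != xI k) -> partial b (f \o @x_coord R n) z = 0.
  move=> bx; rewrite /partial (@derive_pull R _ _ (@x_coord R n) f _ 0 z) ?derive0 //
    => h.
  by rewrite scaler0 add0r x_coord_transverse.
elim/ambient_index_ind: c => [|l|].
- rewrite ttau_v partial_coord /cst ambient_eqE !kindE.
  by case: (kind_of b).
- rewrite ttau_x !kindE; elim/ambient_index_ind: b transverse => [|k|] transverse.
  + by rewrite kindE transverse // => k; rewrite ambient_eqE !kindE.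
  + rewrite kindE /partial (@derive_pull R _ _ (@x_coord R n) _ _ (delta_mx 0 k) z);
    last first.
      by move=> h; exact: x_coord_x.
    by rewrite (jacobianE oV (mf_transition_smooth mA i j) k l Uz).
  + by rewrite kindE transverse // => k; rewrite ambient_eqE !kindE.
- rewrite ttau_u partial_coord /cst ambient_eqE !kindE.
  by case: (kind_of b).
Qed.

Lemma ambient_mx_congr (J B : 'M[R]_n) :
  ambient_mx (J *m B *m J^T) =
  ambient_jacobian J *m ambient_mx B *m (ambient_jacobian J)^T.
Proof.
have JE b c : ambient_jacobian J b c = match kind_of b, kind_of c with
    | KindV, KindV | KindU, KindU => 1
    | KindX k, KindX l => J k l
    | _, _ => 0
    end by rewrite mxE.
apply/matrixP => b c; rewrite ambient_mxE [RHS]mxE ambient_sum.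
have JBE b' c' : (ambient_jacobian J *m ambient_mx B) b' c' =
   match kind_of b', kind_of c' with
    | KindV, KindU | KindU, KindV => 1
    | KindX k, KindX l => (J *m B) k l
    | _, _ => 0
    end.
  rewrite mxE ambient_sum !ambient_mxE !JE !kindE.
  under eq_bigr do rewrite ambient_mxE JE !kindE.
  case: (kind_of b') => [|k|]; case: (kind_of c') => [|l|];
    under eq_bigr do rewrite ?zeroE; rewrite ?big1_eq ?zeroE //.
  by rewrite mxE.
rewrite !JBE; under eq_bigr do rewrite JBE [_^T _ _]mxE JE !kindE.
rewrite ![_^T _ _]mxE !JE !kindE.
case: (kind_of b) => [|k|]; case: (kind_of c) => [|l|];
  under eq_bigr do rewrite ?zeroE; rewrite ?big1_eq ?zeroE //.
by rewrite mxE; apply: eq_bigr => s _; rewrite [J^T _ _]mxE.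
Qed.
End AmbientTransition.

(** * The ambient space *)

Section AmbientChart.
Variables (R : realType) (n : nat) (M : topologicalType) (A : atlas R n M).
Variables (g : tensor2 A) (phi : M -> R) (lambda : R).
Hypothesis hM : is_manifold_with_density g phi.
Hypothesis hcase : gradient_ricci_soliton g phi lambda \/ is_flat g.
Variable W : set (ambient R M).
Hypothesis oW : open W.
Hypothesis hgu : g_u_nondegenerate_on g phi lambda W.
Variable i : chart A.
Let mA : is_manifold A := md_manifold hM.
Let U := chart_image (A := ambient_atlas A) i W.
Let V := chart_image i setT.
Let oU : open U := ambient_image_open mA oW (i := i).
Let oV : open V := chart_image_setT_open mA (i := i).
Let S := smooth_fn oU.
Let d : derivations S (1 + n + 1) := fn_ders oU.
Let D : derivations S n := der_restrict (@xI n) d.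

Let xUV z : U z -> V (x_coord z).
Proof. by case/(ambient_imageE mA). Qed.

Let base_fn f (sf : smooth_on V f) : S :=
  to_fn oU (smooth_comp oU oV xUV (x_coord_smooth U) sf).

Let rep_base_fn f (sf : smooth_on V f) : represents (@x_coord R n) f (base_fn sf).
Proof. by move=> z Uz; rewrite to_fnE. Qed.

Let DE k s : D k s = fn_der (xI k) s. Proof. by []. Qed.

Let G : 'M[S]_n := \matrix_(a, b) base_fn ((md_metric_smooth hM).2 i a b).

Let repG a b : represents (@x_coord R n) (fun y => g i y a b) (G a b).
Proof. by rewrite mxE; exact: rep_base_fn. Qed.

Let evG z : U z -> eval_mx G z = g i (x_coord z).
Proof. exact: eval_metric. Qed.

Let Gi_ex : exists Gi, Gi *m G = 1%:M.
Proof. by apply: mx_inverse => z Uz; rewrite evG //; apply: (metric_unit hM); exact: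
  xUV. Qed.

Let Gi : 'M[S]_n := sval (cid Gi_ex).
Let GiG : Gi *m G = 1%:M := svalP (cid Gi_ex).

Let GT : G^T = G.
Proof.
apply: (eval_mx_eq (oU := oU)) => z Uz.
have -> : eval_mx G^T z = (eval_mx G z)^T by apply/matrixP => a b; rewrite !mxE.
by rewrite evG // (md_metric_riemannian hM (xUV Uz)).1.
Qed.

Let a0 : S := base_fn (md_phi_smooth hM i).
Let lam : S := fn_cst oU lambda.
Let h : S := fn_half oU.
Let h2 : h + h = 1 := fn_halfP oU.
Let Gam := christ_conn D h Gi G.
Let P := Pmx D Gam G lam a0.
Let Y := Ypot D h Gam Gi lam a0.
Let u : S := to_fn oU (u_coord_smooth U).
Let v : S := to_fn oU (v_coord_smooth U).

Let rep_a0 : represents (@x_coord R n) (phi \o chart_param i) a0 := rep_base_fn _.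

Let repP a b : represents (@x_coord R n) (fun y => P_phi g phi lambda i y a b) (P a b).
Proof. exact: (rep_P (@x_coord_x R n) DE repG GiG lambda rep_a0). Qed.

Let repY : represents (@x_coord R n) (Y_loc (g i) (phi \o chart_param i) lambda) Y.
Proof. exact: (rep_Y (@x_coord_x R n) DE repG GiG lambda rep_a0). Qed.

Let repGam k a b : represents (@x_coord R n) (christoffel (g i) k a b) (Gam a b k).
Proof. exact: (rep_conn (@x_coord_x R n) DE repG GiG). Qed.

Let lam0 b : d b lam = 0. Proof. exact: fn_der_cst. Qed.
Let Dlam0 k : D k lam = 0. Proof. exact: lam0. Qed.

Let tf : torsion_free Gam := christ_torsion_free D h Gi GT.
Let mc : metric_compat D Gam G := christ_metric_compat D h2 GiG GT.

Let sf_case : P = 0 \/ forall a b, curv D Gam a b = 0.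
Proof.
case: hcase => [sol|fl]; [left|right=> a b].
  apply/matrixP => a b; rewrite [RHS]mxE; apply: smooth_fn_eq => z Uz.
  by rewrite -repP // (sol i _ (xUV Uz)) mxE fn0E.
apply/matrixP => k l; rewrite [RHS]mxE; apply: smooth_fn_eq => z Uz.
rewrite -(rep_riemann (@x_coord_x R n) DE repG GiG l k a b Uz) fn0E //.
by rewrite (fl i _ (xUV Uz)).
Qed.

(** Moving v or u does not change [x_coord], so the difference quotients are those along the zero
    vector. *)
Let rep_base f s : represents (@x_coord R n) f s -> base_scalar d s.
Proof.
move=> fs; have e b : (forall k, b != xI k) -> d b s = 0.
  move=> bx; apply: smooth_fn_eq => z Uz; rewrite fn0E //.
  rewrite -[d b s]/(fn_der b s) (@fn_der_eq _ _ _ oU b s (f \o @x_coord R n) z Uz fs).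
  rewrite /partial (@derive_pull R _ _ (@x_coord R n) f _ 0 z) ?derive0 // => t.
  by rewrite scaler0 add0r x_coord_transverse.
by split; apply: e => k; rewrite ambient_eqE !kindE.
Qed.

Let G_base : base_mx d G. Proof. by move=> a b; exact: rep_base (repG a b). Qed.
Let Gi_base : base_mx d Gi.
Proof. by move=> a b; exact: rep_base (rep_ginvE repG GiG a b). Qed.
Let P_base : base_mx d P. Proof. by move=> a b; exact: rep_base (repP a b). Qed.
Let Gam_base a : base_mx d (Gam a).
Proof. by move=> b c; exact: rep_base (repGam c a b). Qed.
Let a0_base : base_scalar d a0 := rep_base rep_a0.
Let Y_base : base_scalar d Y := rep_base repY.

Let der_coord (c : 'I_(1 + n + 1)) (f : 'rV[R]_(1 + n + 1) -> R) (sf : smooth_on U f)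
  b :
  (forall z, f z = z 0 c) -> d b (to_fn oU sf) = (c == b)%:R.
Proof.
move=> fE; apply: smooth_fn_eq => z Uz; rewrite fn_natE //.
rewrite -[d b _]/(fn_der b _).
rewrite (@fn_der_eq _ _ _ oU b _ (fun z => z 0 c) z Uz) ?partial_coord //.
by move=> y Uy; rewrite to_fnE.
Qed.

Let du b : d b u = (uI n == b)%:R. Proof. exact/der_coord/u_coordE. Qed.
Let dv b : d b v = (vI n == b)%:R. Proof. exact/der_coord/v_coordE. Qed.
Let duu : d (uI n) u = 1. Proof. by rewrite du eqxx. Qed.
Let dvu : d (vI n) u = 0. Proof. by rewrite du ambient_eqE !kindE. Qed.
Let dxu k : D k u = 0. Proof. by rewrite [LHS]du ambient_eqE !kindE. Qed.
Let duv : d (uI n) v = 0. Proof. by rewrite dv ambient_eqE !kindE. Qed.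
Let dvv : d (vI n) v = 1. Proof. by rewrite dv eqxx. Qed.
Let dxv k : D k v = 0. Proof. by rewrite [LHS]dv ambient_eqE !kindE. Qed.

Let PT : P^T = P := Pmx_sym GT tf sf_case.
Let Q_cod : forall a b, codazzi D Gam (P *m Gi) a b = 0 :=
  codazzi_P Dlam0 GiG tf mc sf_case.
Let dY : dcol D Y = - (P *m Gi *m dcol D a0) :=
  dcol_Ypot h2 Dlam0 GT GiG tf mc sf_case.

Let Q_curv : P *m Gi = 0 \/ forall a b, curv D Gam a b = 0.
Proof. by case: sf_case => [->|fl]; [left; rewrite mul0mx|right]. Qed.

Let Gu := gu u P G Gi.
Let B : 'M[S]_n := 1%:M + u *: (P *m Gi).

Let GuE : Gu = B *m G *m B^T := guE u GT GiG PT.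

Let evP z : U z -> eval_mx P z = P_phi g phi lambda i (x_coord z).
Proof. by move=> Uz; apply/matrixP => a b; rewrite mxE -repP. Qed.

Let evGu z : U z -> eval_mx Gu z = g_u g phi lambda (u_coord z) i (x_coord z).
Proof.
move=> Uz; rewrite /Gu /gu !eval_mxD // !eval_mxZ // !eval_mxM // evG // evP //.
rewrite -(rep_ginv repG GiG Uz) fnME // fn_natE // fn_XE //.
by rewrite /u to_fnE.
Qed.

(** Here the nondegeneracy of g_u enters: B is a left factor of the invertible product B g B^T. *)
Let evB z : U z -> eval_mx B z \in unitmx.
Proof.
move=> Uz; have /(ambient_imageE mA)[Vx Wz] := Uz.
have e : g_u g phi lambda (u_coord z) i (x_coord z) =
    eval_mx B z *m eval_mx G z *m eval_mx B^T z.
  by rewrite -(evGu Uz) GuE (eval_mxM _ _ Uz) (eval_mxM _ _ Uz).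
have := hgu Wz (chart_dom_param mA Vx); rewrite (chart_paramK mA Vx) e.
by rewrite !unitmx_mul => /andP[/andP[]].
Qed.

Let C_ex : exists C, C *m B = 1%:M.
Proof. exact: mx_inverse evB. Qed.

Let C : 'M[S]_n := sval (cid C_ex).
Let CB : C *m B = 1%:M := svalP (cid C_ex).

Let acG := ambient_conn d u P Gi C Gam.
Let Gt := ambient_mx Gu.
Let Gti := ambient_mx (gui Gi C).
Let phit : S := a0 - u * Y - v + lam * u * v.

Let GtT : Gt^T = Gt.
Proof. by rewrite /Gt ambient_mx_tr (gu_tr u GT GiG PT). Qed.

Let GtiGt : Gti *m Gt = 1%:M.
Proof. exact/ambient_mxM/(gui_gu GT GiG PT CB). Qed.

Let acG_tf : torsion_free acG := ambient_conn_torsion_free C dxu GT GiG PT tf Q_cod.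
Let acG_mc : metric_compat d acG Gt :=
  ambient_conn_compat duu dvu G_base Gi_base P_base GT GiG PT mc CB.

(** Uniqueness of the Levi-Civita connection replaces the computation of the Christoffel symbols of
    the ambient metric. *)
Let christ_acG : christ_conn d h Gti Gt = acG.
Proof.
apply/funext => b; apply: (levi_civita_unique h2 GtiGt GtT _ _ acG_tf acG_mc).
  exact: christ_torsion_free.
exact: christ_metric_compat.
Qed.

Let rep_Gt a b : represents id (fun z => g_tilde g phi lambda i z a b) (Gt a b).
Proof.
move=> z Uz; rewrite -[g_tilde _ _ _ _ _]/(ambient_mx (g_u g phi lambda (u_coord z) i
  (x_coord z))).
rewrite -evGu // /Gt !ambient_mxE.
by case: (kind_of a) => [|k|]; case: (kind_of b) => [|l|]; rewrite ?fn0E ?fn1E // mxE.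
Qed.

Local Notation phi_chart := (phi_tilde g phi lambda \o chart_param (a :=
  ambient_atlas A) i).

Let rep_phit : represents id phi_chart phit.
Proof.
move=> z Uz; transitivity (phi (chart_param i (x_coord z))
    - u_coord z * Y_phi g phi lambda (chart_param i (x_coord z))
    - v_coord z + lambda * u_coord z * v_coord z) => //.
rewrite (Y_phi_chart hM hcase (xUV Uz)) /phit.
rewrite fnDE // fnDE // fnNE // fnDE // fnNE // fnME // fnME // fnME //.
by rewrite -rep_a0 // -repY // /u /v /lam !to_fnE.
Qed.

Lemma ambient_chart_metric_smooth a b :
  smooth_on U (fun z => g_tilde g phi lambda i z a b).
Proof. by apply: (smooth_eq oU _ (smooth_fnP (Gt a b))) => z Uz; rewrite rep_Gt. Qed.

Lemma ambient_chart_phi_smooth : smooth_on U phi_chart.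
Proof. by apply: (smooth_eq oU _ (smooth_fnP phit)) => z Uz; rewrite -rep_phit. Qed.

Let pull_id (k : 'I_(1 + n + 1)) (t : R) (z : 'rV[R]_(1 + n + 1)) :
  id (t *: delta_mx 0 (id k) + z) = t *: delta_mx 0 k + id z.
Proof. by []. Qed.

Lemma ambient_chart_christoffel k z : U z ->
  christoffel (g_tilde g phi lambda i) k (v_index n) (v_index n) z = 0.
Proof.
move=> Uz.
rewrite (rep_conn (pull := id) (e := id) pull_id (D := d) (fun _ _ => erefl) rep_Gt
  GtiGt) //.
by rewrite christ_acG mxE !kindE fn0E.
Qed.

Lemma ambient_chart_P a b z : U z ->
  P_phi (g_tilde g phi lambda) (phi_tilde g phi lambda) lambda i z a b = 0.
Proof.
move=> Uz.
have := rep_P (pull := id) (e := id) pull_id (D := d) (fun _ _ => erefl) rep_Gt GtiGt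
  lambda rep_phit a b Uz.
rewrite /P_phi => ->; rewrite -/h christ_acG /Pmx.
rewrite (ambient_P lam0 duu dvu dxu duv dvv dxv a0_base Y_base Gi_base P_base Gam_base
  GT GiG PT CB Q_cod dY (erefl P) Q_curv).
by rewrite mxE fn0E.
Qed.

Lemma ambient_chart_F z : U z ->
  F_loc (g_tilde g phi lambda i) phi_chart lambda z = 0.
Proof.
move=> Uz.
have := rep_F (pull := id) (e := id) pull_id (D := d) (fun _ _ => erefl) rep_Gt GtiGt
  lambda rep_phit Uz.
move=> ->; rewrite -/h christ_acG.
rewrite (ambient_F h2 lam0 duu dvu dxu duv dvv dxv a0_base Y_base Gi_base P_base
  Gam_base
  GT GiG PT CB Q_cod dY (erefl Y) (erefl P) Q_curv).
by rewrite fn0E.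
Qed.

(** g_u is congruent to g through B, hence positive definite wherever it is nondegenerate, and not
    merely for small u. *)
Lemma ambient_chart_signature z : U z ->
  (g_tilde g phi lambda i z)^T = g_tilde g phi lambda i z /\
  has_signature n.+1 1 (g_tilde g phi lambda i z).
Proof.
move=> Uz.
have -> : g_tilde g phi lambda i z = ambient_mx (eval_mx Gu z) by rewrite evGu.
have GuT : (eval_mx Gu z)^T = eval_mx Gu z.
  have e : Gu^T = Gu := gu_tr u GT GiG PT.
  have eT : eval_mx Gu^T z = (eval_mx Gu z)^T.
    by move: Gu => X; apply/matrixP => a b; rewrite !mxE.
  by rewrite -eT e.
rewrite ambient_mx_tr GuT; split => //; apply: ambient_mx_signature => //.
have -> : eval_mx Gu z = eval_mx B z *m g i (x_coord z) *m (eval_mx B z)^T.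
  rewrite GuE !eval_mxM // evG //; congr (_ *m _).
  by apply/matrixP => a b; rewrite !mxE.
by apply: posdef_congr; [exact: evB|exact: (md_metric_riemannian hM (xUV Uz)).2].
Qed.
End AmbientChart.

(** Vanishing on an open set gives every order in u at once, with an arbitrary constant. *)
Lemma O_u_eq0 (R : realType) (n N : nat) (U : set 'rV[R]_(1 + n + 1))
    (f : 'rV[R]_(1 + n + 1) -> R) :
  open U -> (forall z, U z -> f z = 0) -> O_u N U f.
Proof.
move=> oU f0 z Uz _; apply/eqO_exP; exists 1 => //.
have nU : nbhs z U by exact: open_nbhs_nbhs.
by apply: filterS nU => y Uy; rewrite f0 // normr0 mul1r.
Qed.

Lemma ambient_tensorial (R : realType) (n : nat) (M : topologicalType)
    (A : atlas R n M) (g : tensor2 A) (phi : M -> R) (lambda : R)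
    (W : set (ambient R M)) :
  is_manifold_with_density g phi ->
  gradient_ricci_soliton g phi lambda \/ is_flat g ->
  tensorial_on W (g_tilde g phi lambda).
Proof.
move=> hM hcase i j [[v q] u] Wp iq jq J.
have mA := md_manifold hM.
have gtE (k : chart A) : g_tilde g phi lambda k
      (@chart_coord _ _ _ (ambient_atlas A) k ((v, q, u) : ambient R M)) =
    ambient_mx (g_u g phi lambda u k (@chart_coord _ _ _ A k q)).
  have [_ xE uE] := coords_row v (@chart_coord _ _ _ A k q) u.
  by rewrite -{2}uE -{2}xE.
have Uq : @chart_image _ _ _ A i (chart_dom (j : chart A)) (@chart_coord _ _ _ A i q).
  by exists q.
have xE : x_coord (@chart_coord _ _ _ (ambient_atlas A) i ((v, q, u) : ambient R M)) =
    @chart_coord _ _ _ A i q.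
  by have [] := coords_row v (@chart_coord _ _ _ A i q) u.
have tq : @transition _ _ _ A i j (@chart_coord _ _ _ A i q) = @chart_coord _ _ _ A j q.
  by rewrite /transition /= (mf_coordK mA).
rewrite !gtE (g_u_tau hM hcase u Uq) tq.
have Uz : (@x_coord R n @^-1` @chart_image _ _ _ A i (chart_dom (j : chart A)))
    (@chart_coord _ _ _ (ambient_atlas A) i ((v, q, u) : ambient R M)).
  by rewrite /preimage /= -/(x_coord _) xE.
have := jacobian_ambient mA Uz; rewrite xE => JE.
by rewrite ambient_mx_congr /J JE.
Qed.

Theorem theorem1p2 (R : realType) (n : nat) (M : topologicalType)
    (A : atlas R n M) (g : tensor2 A) (phi : M -> R) (lambda : R)
    (hM : is_manifold_with_density g phi)
    (hcase : gradient_ricci_soliton g phi lambda \/ is_flat g)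
    (W : set (ambient R M))
    (hW : dilation_invariant_nbhd lambda W)
    (hgu : g_u_nondegenerate_on g phi lambda W) :
  is_weighted_ambient_space g phi lambda W
    (g_tilde g phi lambda) (phi_tilde g phi lambda).
Proof.
have oW := din_open hW.
have oU (i : chart A) : open (chart_image (A := ambient_atlas A) i W).
  exact: (@ambient_image_open _ _ _ _ (md_manifold hM) _ oW i).
split; last 2 first.
- move=> i a b N; apply: (O_u_eq0 _ (oU i)) => z Uz.
  exact: (ambient_chart_P hM hcase oW hgu a b Uz).
- move=> i N; apply: (O_u_eq0 _ (oU i)) => z Uz.
  exact: (ambient_chart_F hM hcase oW hgu Uz).
split.
- exact: hW.
- split; first exact: ambient_tensorial.
  by move=> i a b; exact: (ambient_chart_metric_smooth lambda hM oW i a b).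
- by move=> i z Uz; exact: (ambient_chart_signature hM hcase oW hgu Uz).
- by move=> i; exact: (ambient_chart_phi_smooth hM hcase oW i).
- by move=> i z z' _ _ xz uz; rewrite /g_tilde xz uz.
(* The potential is affine in v with slope lambda u - 1, which is nonzero on W and is the
   denominator in the dilation. *)
- move=> s z Wz; have := din_dilation_defined hW Wz.
  rewrite /phi_tilde /phi_u /dilation /= => l1.
  have l0 : lambda * z.2 - 1 != 0 by rewrite subr_eq0.
  by field.
- move=> i z _ u0; rewrite /g_tilde u0 block_mxKul /cone_metric; congr block_mx.
  by rewrite /g_u mulr0 scale0r addr0 expr0n scale0r addr0.
- by move=> v x; rewrite /phi_tilde /phi_u /cone_phi /cone_of_coord /=; ring.
- move=> i k; apply: (O_u_eq0 _ (oU i)) => z Uz.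
  exact: (ambient_chart_christoffel hM hcase oW hgu k Uz).
Qed.
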